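(* Let $n\ge 1$ and $\mathbf{w}=(w_1,\dots,w_n)\in\mathbb{Z}_{\ge 0}^n$. For any $Y=(y_{ij})\in\mathbf{P}(\mathbf{w})$, $$\dim\mathcal{O}_Y=\sum_{\substack{1\le i\le n-1\\ 1\le j<k\le n-i+1}}y_{ij}y_{ik}+\sum_{\substack{1\le i\le n-1\\ 1\le j<k\le n-i+1}}y_{i+1,j}y_{ik}.$$
   Context: $\mathbf{P}(\mathbf{w})$ is the set of triangular arrays $Y=(y_{ij})_{1\le i\le n,\,1\le j\le n-i+1}$ of nonnegative integers with $\sum_{j=1}^{n-i+1}y_{ij}=w_i$ for all $i$ and $y_{ij}\ge y_{i-1,j+1}$ for all $i\ge 2$ and all $j$. $E(\mathbf{w})=\prod_{i=1}^{n-1}\mathrm{Hom}(\mathbb{C}^{w_i},\mathbb{C}^{w_{i+1}})$ is the space of representations $x=(x_1,\dots,x_{n-1})$ of the equioriented quiver $\bullet\to\bullet\to\cdots\to\bullet$ with $n$ vertices; $G(\mathbf{w})=\prod_{i=1}^n\mathrm{GL}(w_i)$ acts by $(g_i)\cdot(x_i)=(g_{i+1}x_ig_i^{-1})$. For $x\in E(\mathbf{w})$, $M(x)$ denotes the corresponding quiver representation. For $1\le i\le j\le n$, $R_{ij}$ is the indecomposable representation with $\mathbb{C}$ at vertices $i,\dots,j$, zero elsewhere, and identity maps between consecutive copies of $\mathbb{C}$. For $Y\in\mathbf{P}(\mathbf{w})$ put $\nu(Y)_{ij}=y_{i,j-i+1}-y_{i-1,j-i+2}$ for $1\le i\le j\le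 n$ (the second term is $0$ if $i=1$). Then $\mathcal{O}_Y\subset E(\mathbf{w})$ is the $G(\mathbf{w})$-orbit of those $x$ with $M(x)\cong\bigoplus_{i\le j}R_{ij}^{\oplus\nu(Y)_{ij}}$. Dimension means dimension as a complex algebraic variety. *)

(* Defs.v *)
From HB Require Import structures.
From mathcomp Require Import all_boot all_order all_algebra.
From mathcomp Require Import complex.
From mathcomp Require Import classical_sets reals.
From mathcomp Require Import mpoly.

Set Implicit Arguments.
Unset Strict Implicit.
Unset Printing Implicit Defensive.

Import Order.TTheory GRing.Theory Num.Theory.

Local Open Scope classical_set_scope.
Local Open Scope ring_scope.

(* All indices are shifted to start at 0: vertices are 0, ..., n-1, the arrows *)
(* are 0, ..., n-2, and the arrow a goes from the vertex a to the vertex a+1.  *)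
Definition src (n : nat) (a : 'I_n.-1) : 'I_n := widen_ord (leq_pred n) a.

Definition tgt (n : nat) (a : 'I_n.-1) : 'I_n :=
  Ordinal (etrans (esym (ltn_predRL a n)) (ltn_ord a)).

Section Representations.
Variables (F : fieldType) (n : nat).

(* Matrices act on column vectors: Hom(F^p, F^q) is 'M[F]_(q, p). *)
Definition repSpace (w : 'I_n -> nat) : Type :=
  forall a : 'I_n.-1, 'M[F]_(w (tgt a), w (src a)).

Record quiverRep := QuiverRep {
  rdim : 'I_n -> nat;
  rmap : repSpace rdim }.

Definition rep0 : quiverRep := @QuiverRep (fun=> 0%N) (fun=> 0).

Definition dsum (M N : quiverRep) : quiverRep :=
  @QuiverRep (fun v => rdim M v + rdim N v)%N
             (fun a => block_mx (rmap M a) 0 0 (rmap N a)).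

(* When i <= a and a+1 <= j the matrix const_mx 1 is the 1 x 1 identity;       *)
(* otherwise it is an empty matrix.                                            *)
Definition intervalRep (i j : nat) : quiverRep :=
  @QuiverRep (fun v => nat_of_bool (i <= v <= j)%N) (fun=> const_mx 1).

Definition rep_iso (M N : quiverRep) : Prop :=
  exists (phi : forall v, 'M[F]_(rdim N v, rdim M v))
         (psi : forall v, 'M[F]_(rdim M v, rdim N v)),
    [/\ forall v, psi v *m phi v = 1%:M,
        forall v, phi v *m psi v = 1%:M
      & forall a, phi (tgt a) *m rmap M a = rmap N a *m phi (src a)].

Definition act (w : 'I_n -> nat) (g : forall v, 'M[F]_(w v))
    (x : repSpace w) : repSpace w :=
  fun a => g (tgt a) *m x a *m invmx (g (src a)).

(* Hence the set orbit_of_array below, if nonempty, is one orbit of the group  *)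
(* of families of invertible matrices.                                         *)
Lemma rep_iso_act (w : 'I_n -> nat) (x x' : repSpace w) :
  rep_iso (QuiverRep x) (QuiverRep x') <->
  exists2 g : forall v, 'M[F]_(w v),
    forall v, g v \in unitmx & forall a, x' a = act g x a.
Proof.
split=> [[phi [psi [pK Kp /= px]]]|[g gU gx]].
  have U v : phi v \in unitmx by have [] := mulmx1_unit (Kp v).
  by exists phi => // a; rewrite /act px -mulmxA mulmxV ?mulmx1.
exists g, (fun v => invmx (g v)); split=> [v|v|a] /=.
- exact: mulVmx.
- exact: mulmxV.
- by rewrite gx /act -!mulmxA mulVmx // mulmx1.
Qed.

End Representations.

Section Zariski.
Variables (F : fieldType) (n : nat) (w : 'I_n -> nat).

Definition coord : finType :=
  {a : 'I_n.-1 & ('I_(w (tgt a)) * 'I_(w (src a)))%type}.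

Definition entry (x : repSpace F w) (t : coord) : F :=
  x (tag t) (tagged t).1 (tagged t).2.

Definition peval (p : {mpoly F[#|coord|]}) (x : repSpace F w) : F :=
  p.@[fun k => entry x (enum_val k)].

Definition zariski_closed (Z : set (repSpace F w)) : Prop :=
  exists S : set {mpoly F[#|coord|]},
    Z = [set x | forall p, S p -> peval p x = 0].

Definition closed_in (A Z : set (repSpace F w)) : Prop :=
  exists2 Z', zariski_closed Z' & Z = A `&` Z'.

Definition irreducible (Z : set (repSpace F w)) : Prop :=
  Z !=set0 /\
  forall Z1 Z2, closed_in Z Z1 -> closed_in Z Z2 ->
    Z = Z1 `|` Z2 -> Z = Z1 \/ Z = Z2.

Definition irreducible_chain (A : set (repSpace F w)) (d : nat)
    (Z : nat -> set (repSpace F w)) : Prop :=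
  (forall k, (k <= d)%N -> closed_in A (Z k) /\ irreducible (Z k)) /\
  (forall k, (k < d)%N -> Z k `<` Z k.+1).

(* Krull dimension of A for the topology induced by the Zariski topology.      *)
Definition has_dim (A : set (repSpace F w)) (d : nat) : Prop :=
  (exists Z, irreducible_chain A d Z) /\
  (forall e Z, irreducible_chain A e Z -> (e <= d)%N).

End Zariski.

(* A triangular array is encoded as a function of which only the values Y i j  *)
(* with i < n and j < n - i are ever read.                                     *)
Definition triangular_arrays (n : nat) (w : 'I_n -> nat) :
    set (nat -> nat -> nat) :=
  [set Y : nat -> nat -> nat |
    (forall i : 'I_n, (\sum_(j < n - i) Y i j)%N = w i) /\
    (forall i j, (i.+1 < n)%N -> (j < n - i.+1)%N ->
       (Y i j.+1 <= Y i.+1 j)%N)].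

Definition nu (Y : nat -> nat -> nat) (i j : nat) : nat :=
  (Y i (j - i) - (if i is i'.+1 then Y i' (j - i).+1 else 0))%N.

Definition rep_of_array (F : fieldType) (n : nat) (Y : nat -> nat -> nat) :
    quiverRep F n :=
  \big[@dsum F n/rep0 F n]_(0 <= i < n)
    \big[@dsum F n/rep0 F n]_(i <= j < n)
      \big[@dsum F n/rep0 F n]_(0 <= m < nu Y i j) intervalRep F n i j.

Definition orbit_of_array (F : fieldType) (n : nat) (w : 'I_n -> nat)
    (Y : nat -> nat -> nat) : set (repSpace F w) :=
  [set x | rep_iso (QuiverRep x) (rep_of_array F n Y)].

Arguments orbit_of_array F {n} w Y.

(* Main.v *)
Require Import Defs.
From mathcomp Require Import all_boot all_order all_algebra.
From mathcomp Require Import fingroup perm.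
From mathcomp Require Import complex.
From mathcomp Require Import boolp classical_sets reals.
From mathcomp Require Import mpoly zify.

(** The dimension is the number of parameters of an affine cell that maps onto a
    dense part of the orbit. Split the basis of the vertex [i] into consecutive
    blocks of sizes [Y i 0], [Y i 1], ...; the level of a basis vector is the
    index of its block. The orbit contains the representation [base_rep] whose
    arrows permute basis vectors: a vector of level [l + 1] goes to a vector of
    level [l] in the same position of its block, and a vector of level [0] goes
    to [0]. So a vector of level [l] dies after exactly [l + 1] arrows, and the
    flags spanned by the vectors of bounded level are the kernels of the
    composite maps. Any [x] in the orbit becomes strictly block upper triangular
    once these flags are moved to standard position, which a unipotent block
    lower triangular matrix does at each vertex when the flags are in general
    position. This gives the map [cell]: it sends block lower unipotent matrices
    [v_i] and strictly upper matrices [N_i] to [v_(i+1)^-1 N_i v_i]. The entries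
    of the [v_i] contribute the first sum of the formula, those of the [N_i] the
    second ([card_parameter]).

    The Krull dimension is computed from [cell] without a general theory of
    dimension.

    Upper bound ([chain_length_le]). Along a chain of [e] strict inclusions of
    irreducible closed sets choose, at each step, a polynomial that vanishes on
    the smaller set but not on the larger one. Products of powers of these
    polynomials with exponents below [m] are linearly independent on the largest
    set ([chain_free_on]), so there are [m ^ e] independent functions of degree
    [O(m)]. By an LU decomposition the orbit is covered by finitely many
    translates of the image of [cell] under permutation matrices
    ([translated_cells_cover]), and polynomials of degree [O(m)] in [d]
    parameters form a space of dimension [O(m ^ d)]. Hence [e <= d].

    Lower bound ([chain_of_images]). Near the base point the image of [cell] lies
    in the orbit ([cell_in_orbit]). Free the parameters one at a time and take
    closures of images: these sets are irreducible because they are closures of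
    images of open parts of affine spaces. With the right order on the
    parameters, at the moment when a parameter is freed it equals an entry of
    [cell t] ([parameter_detected]), so every inclusion is strict. *)

Set Implicit Arguments.
Unset Strict Implicit.
Unset Printing Implicit Defensive.

Import Order.TTheory GRing.Theory Num.Theory.

Local Open Scope ring_scope.

(** * Polynomial functions on a coordinate space *)

Lemma msizeM_leS (R : idomainType) (N k1 k2 : nat) (p q : {mpoly R[N]}) :
  (msize p <= k1.+1)%N -> (msize q <= k2.+1)%N -> (msize (p * q) <= (k1 + k2).+1)%N.
Proof.
have [->|p0] := eqVneq p 0; first by rewrite mul0r msize0.
have [->|q0] := eqVneq q 0; first by rewrite mulr0 msize0.
by rewrite msizeM //; move: (msize p) (msize q) => a b; lia.
Qed.

Lemma msizeX_leS (R : idomainType) (N k s : nat) (p : {mpoly R[N]}) :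
  (msize p <= k.+1)%N -> (msize (p ^+ s) <= (k * s).+1)%N.
Proof.
move=> sp; elim: s => [|s IH]; first by rewrite expr0 msize1.
by rewrite exprS mulnS; apply: msizeM_leS.
Qed.

Section PolynomialFunctions.
Variables (F : fieldType) (T : finType).
Implicit Types (p : {mpoly F[#|T|]}) (h : (T -> F) -> F) (t : T -> F).

Definition mev p t : F := p.@[fun k => t (enum_val k)].

Definition polydeg (k : nat) h : Prop :=
  exists2 p, (msize p <= k.+1)%N & forall t, h t = mev p t.

Definition polyfun h : Prop := exists p, forall t, h t = mev p t.

Lemma polydegW k k' h : (k <= k')%N -> polydeg k h -> polydeg k' h.
Proof. by move=> le_kk' [p sp hp]; exists p => //; apply: leq_trans sp _. Qed.

Lemma polydeg_polyfun k h : polydeg k h -> polyfun h.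
Proof. by case=> p _ hp; exists p. Qed.

Lemma polyfun_polydeg h : polyfun h -> exists k, polydeg k h.
Proof. by case=> p hp; exists (msize p), p => //; apply: leqnSn. Qed.

Lemma eq_polydeg k h h' : h =1 h' -> polydeg k h -> polydeg k h'.
Proof. by move=> eqh [p sp hp]; exists p => // t; rewrite -eqh. Qed.

Lemma eq_polyfun h h' : h =1 h' -> polyfun h -> polyfun h'.
Proof. by move=> eqh [p hp]; exists p => t; rewrite -eqh. Qed.

Lemma polydegC k c : polydeg k (fun=> c).
Proof.
exists c%:MP; last by move=> t; rewrite /mev mevalC.
by rewrite msizeC; case: eqP.
Qed.

Lemma polydegD k h1 h2 :
  polydeg k h1 -> polydeg k h2 -> polydeg k (fun t => h1 t + h2 t).
Proof.
move=> [p1 s1 hp1] [p2 s2 hp2]; exists (p1 + p2).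
  by apply: leq_trans (msizeD_le _ _) _; rewrite geq_max s1 s2.
by move=> t; rewrite /mev mevalD hp1 hp2.
Qed.

Lemma polydegM k1 k2 h1 h2 :
  polydeg k1 h1 -> polydeg k2 h2 -> polydeg (k1 + k2) (fun t => h1 t * h2 t).
Proof.
move=> [p1 s1 hp1] [p2 s2 hp2]; exists (p1 * p2).
  exact: msizeM_leS.
by move=> t; rewrite /mev mevalM hp1 hp2.
Qed.

Lemma polydeg_sum k (I : Type) (r : seq I) (P : pred I)
    (h : I -> (T -> F) -> F) :
  (forall i, polydeg k (h i)) -> polydeg k (fun t => \sum_(i <- r | P i) h i t).
Proof.
move=> hP; elim: r => [|i r IH].
  by apply: eq_polydeg (polydegC k 0) => t; rewrite big_nil.
case Pi: (P i); last by apply: eq_polydeg IH => t; rewrite big_cons Pi.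
by apply: eq_polydeg (polydegD (hP i) IH) => t; rewrite big_cons Pi.
Qed.

Lemma polydeg_prod (I : Type) (r : seq I) (k : I -> nat)
    (h : I -> (T -> F) -> F) :
  (forall i, polydeg (k i) (h i)) ->
  polydeg (\sum_(i <- r) k i) (fun t => \prod_(i <- r) h i t).
Proof.
move=> hP; elim: r => [|i r IH].
  by apply: eq_polydeg (polydegC _ 1) => t; rewrite big_nil.
rewrite big_cons.
by apply: eq_polydeg (polydegM (hP i) IH) => t; rewrite big_cons.
Qed.

Lemma polydegX k h m : polydeg k h -> polydeg (k * m) (fun t => h t ^+ m).
Proof.
move=> hP; elim: m => [|m IH].
  by apply: eq_polydeg (polydegC _ 1) => t; rewrite expr0.
by rewrite mulnS; apply: eq_polydeg (polydegM hP IH) => t; rewrite exprS.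
Qed.

Lemma polyfun_var x : polyfun (fun t => t x).
Proof.
by exists 'X_(enum_rank x) => t; rewrite /mev mevalXU enum_rankK.
Qed.

Lemma polyfunC c : polyfun (fun=> c).
Proof. exact: polydeg_polyfun (polydegC 0 c). Qed.

Lemma polyfunD h1 h2 :
  polyfun h1 -> polyfun h2 -> polyfun (fun t => h1 t + h2 t).
Proof.
by move=> [p1 hp1] [p2 hp2]; exists (p1 + p2) => t; rewrite /mev mevalD hp1 hp2.
Qed.

Lemma polyfunM h1 h2 :
  polyfun h1 -> polyfun h2 -> polyfun (fun t => h1 t * h2 t).
Proof.
by move=> [p1 hp1] [p2 hp2]; exists (p1 * p2) => t; rewrite /mev mevalM hp1 hp2.
Qed.

Lemma polyfun_sum (I : Type) (r : seq I) (P : pred I)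
    (h : I -> (T -> F) -> F) :
  (forall i, polyfun (h i)) -> polyfun (fun t => \sum_(i <- r | P i) h i t).
Proof.
move=> hP; elim: r => [|i r IH].
  by apply: eq_polyfun (polyfunC 0) => t; rewrite big_nil.
case Pi: (P i); last by apply: eq_polyfun IH => t; rewrite big_cons Pi.
by apply: eq_polyfun (polyfunD (hP i) IH) => t; rewrite big_cons Pi.
Qed.

Lemma polyfun_prod (I : Type) (r : seq I) (P : pred I)
    (h : I -> (T -> F) -> F) :
  (forall i, polyfun (h i)) -> polyfun (fun t => \prod_(i <- r | P i) h i t).
Proof.
move=> hP; elim: r => [|i r IH].
  by apply: eq_polyfun (polyfunC 1) => t; rewrite big_nil.
case Pi: (P i); last by apply: eq_polyfun IH => t; rewrite big_cons Pi.
by apply: eq_polyfun (polyfunM (hP i) IH) => t; rewrite big_cons Pi.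
Qed.

Definition polymx m n (M : (T -> F) -> 'M[F]_(m, n)) : Prop :=
  forall i j, polyfun (fun t => M t i j).

Lemma polymxC m n (M : 'M[F]_(m, n)) : polymx (fun=> M).
Proof. by move=> i j; apply: polyfunC. Qed.

Lemma polymxM m n q (M : (T -> F) -> 'M[F]_(m, n))
    (N : (T -> F) -> 'M[F]_(n, q)) :
  polymx M -> polymx N -> polymx (fun t => M t *m N t).
Proof.
move=> Mp Np i j.
apply: (@eq_polyfun (fun t => \sum_k M t i k * N t k j)) => [t|].
  by rewrite mxE.
by apply: polyfun_sum => k; apply: polyfunM.
Qed.

Lemma polyfun_det m (M : (T -> F) -> 'M[F]_m) :
  polymx M -> polyfun (fun t => \det (M t)).
Proof.
move=> Mp; rewrite /determinant; apply: polyfun_sum => s.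
by apply: polyfunM (polyfunC _) _; apply: polyfun_prod => i; apply: Mp.
Qed.

Lemma polymx_adj m (M : (T -> F) -> 'M[F]_m) :
  polymx M -> polymx (fun t => \adj (M t)).
Proof.
move=> Mp i j.
apply: (@eq_polyfun (fun t => cofactor (M t) j i)) => [t|]; first by rewrite mxE.
rewrite /cofactor; apply: polyfunM (polyfunC _) _; apply: polyfun_det => k l.
apply: (@eq_polyfun (fun t => M t (lift j k) (lift i l))) => [t|].
  by rewrite !mxE.
exact: Mp.
Qed.

(** Restricting to a line turns polynomial functions into univariate
    polynomials, which have finitely many zeros; this is how nonempty
    principal open sets will be shown to meet. *)
Lemma polyfun_line h t u : polyfun h ->
  exists q : {poly F}, forall s, h (fun x => t x + s * (u x - t x)) = q.[s].
Proof.
case=> p hp.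
exists (mmap (@polyC F)
  (fun k => (t (enum_val k))%:P + 'X * (u (enum_val k) - t (enum_val k))%:P) p).
move=> s; rewrite hp /mev mevalE /mmap horner_sum.
apply: eq_bigr => m _; rewrite hornerM hornerC; congr (_ * _).
rewrite /mmap1 horner_prod; apply: eq_bigr => i _.
by rewrite !hornerE.
Qed.

End PolynomialFunctions.

Section Composition.
Variables (F : fieldType) (S T : finType).
Variable h : S -> (T -> F) -> F.

Lemma polydeg_comp D k (p : {mpoly F[#|S|]}) :
  (forall s, polydeg D (h s)) -> (msize p <= k.+1)%N ->
  polydeg (D * k) (fun t => mev p (fun s => h s t)).
Proof.
move=> hD sp.
apply: (@eq_polydeg _ _ _ (fun t => \sum_(m <- msupp p)
   if (mdeg m <= k)%N then p@_m * \prod_i h (enum_val i) t ^+ m i else 0)).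
  move=> t; rewrite /mev mevalE !big_seq; apply: eq_bigr => m mp.
  by have := leq_trans (msize_mdeg_lt mp) sp; rewrite ltnS => ->.
apply: polydeg_sum => m; case: leqP => [mk|_]; last exact: polydegC.
apply: (@polydegW _ _ (0 + D * mdeg m)); first by rewrite leq_mul2l mk orbT.
apply: (polydegM (polydegC _ 0 p@_m)).
rewrite mdegE big_distrr /=.
apply: (@polydeg_prod _ _ _ _ _ (fun i t => h (enum_val i) t ^+ m i)) => i.
exact: polydegX.
Qed.

Lemma polydeg_bound : (forall s, polyfun (h s)) ->
  exists D, forall s, polydeg D (h s).
Proof.
move=> hp; suff [D HD] : exists D, forall s, s \in enum S -> polydeg D (h s).
  by exists D => s; apply: HD; rewrite mem_enum.
elim: (enum S) => [|s l [D IH]]; first by exists 0%N.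
have [k hk] := polyfun_polydeg (hp s).
exists (maxn k D) => s'; rewrite inE => /predU1P[->|s'l].
  exact: polydegW (leq_maxl _ _) hk.
exact: polydegW (leq_maxr _ _) (IH _ s'l).
Qed.

Lemma polyfun_comp (p : {mpoly F[#|S|]}) : (forall s, polyfun (h s)) ->
  polyfun (fun t => mev p (fun s => h s t)).
Proof.
case/polydeg_bound=> D hD.
exact: polydeg_polyfun (polydeg_comp hD (leqnSn (msize p))).
Qed.

End Composition.

(** * Chains of irreducible sets and linearly independent functions *)

Lemma card_bmultinom_le N K : (#|{: 'X_{1..N < K.+1}}| <= K.+1 ^ N)%N.
Proof.
pose toex (m : 'X_{1..N < K.+1}) : {ffun 'I_N -> 'I_K.+1} :=
  [ffun k => inord (bmnm m k)].
have inj : injective toex.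
  have lt (m : 'X_{1..N < K.+1}) k : (bmnm m k < K.+1)%N.
    by apply: leq_ltn_trans (bmdeg m); rewrite mdegE (bigD1 k) //= leq_addr.
  move=> m m' /ffunP e; apply/val_inj/mnmP => k.
  by have /(congr1 val) := e k; rewrite !ffunE /= !inordK.
by rewrite (leq_trans (leq_card toex inj)) // card_ffun !card_ord.
Qed.

Section LinearIndependence.
Variables (F : fieldType) (X : Type).

Definition free_on (Z : X -> Prop) (I : finType) (h : I -> X -> F) : Prop :=
  forall c : I -> F,
    (forall x, Z x -> \sum_i c i * h i x = 0) -> forall i, c i = 0.

(** If [I] were larger than [J], the matrix [a] would have a nonzero row vector
    in its kernel, that is, a linear relation between the [h i]. *)
Lemma free_on_card_le (Z : X -> Prop) (I J : finType)
    (h : I -> X -> F) (g : J -> X -> F) (a : I -> J -> F) :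
  (forall i x, h i x = \sum_j a i j * g j x) -> free_on Z h ->
  (#|I| <= #|J|)%N.
Proof.
move=> hE freeh; rewrite leqNgt; apply/negP => ltJI.
pose M : 'M[F]_(#|I|, #|J|) := \matrix_(i, j) a (enum_val i) (enum_val j).
have kerN0 : kermx M != 0.
  by rewrite kermx_eq0 /row_free neq_ltn (leq_ltn_trans (rank_leq_col M) ltJI).
have /rowV0Pn[v vM vN0] := kerN0.
move/sub_kermxP: vM => vM0.
case/negP: vN0; apply/eqP/rowP => i; rewrite mxE.
rewrite -(enum_valK i).
apply: (freeh (fun i => v 0 (enum_rank i))) => x _.
under eq_bigr => k _ do rewrite hE big_distrr /=.
rewrite exchange_big /= big1 // => j _.
under eq_bigr => k _ do rewrite mulrA.
rewrite -big_distrl /= (reindex (@enum_val I I)) /=; last first.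
  by exists enum_rank => k _; rewrite ?enum_valK ?enum_rankK.
have /rowP /(_ (enum_rank j)) := vM0; rewrite !mxE => e0.
rewrite [X in X * _](_ : _ = 0) ?mul0r // -[RHS]e0.
by apply: eq_bigr => k _; rewrite mxE enum_valK enum_rankK.
Qed.

End LinearIndependence.

Section Chains.
Variables (F : fieldType) (n : nat) (w : 'I_n -> nat).
Local Notation E := (repSpace F w).
Local Notation C := (Defs.coord w).
Implicit Types (Z A : set E) (p q : {mpoly F[#|C|]}).

Definition vanishes_on p Z : Prop := forall x, Z x -> peval p x = 0.

Lemma pevalE p (x : E) : peval p x = mev p (entry x). Proof. by []. Qed.

Lemma closed_in_zeros Z p : closed_in Z (Z `&` [set x | peval p x = 0])%classic.
Proof.
exists [set x | peval p x = 0]%classic => //.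
exists [set p]%classic; apply/seteqP; split=> [x px q -> //|x /(_ p)]; exact.
Qed.

(** Functions on an irreducible set form an integral domain. *)
Lemma irreducible_vanishes_mul Z p q : irreducible Z ->
  vanishes_on (p * q) Z -> vanishes_on p Z \/ vanishes_on q Z.
Proof.
case=> _ irr pq0.
have [|e|e] := irr _ _ (closed_in_zeros Z p) (closed_in_zeros Z q).
- apply/seteqP; split=> x /=; last by case=> [] [].
  move=> Zx; have /eqP := pq0 x Zx; rewrite pevalE /mev mevalM mulf_eq0.
  by case/orP=> /eqP e; [left|right].
- by left=> x; rewrite {1}e => -[].
- by right=> x; rewrite {1}e => -[].
Qed.

Lemma closed_in_separation A Z Z' : closed_in A Z -> (Z' `<=` A)%classic ->
  ~ (Z' `<=` Z)%classic -> exists2 p, vanishes_on p Z & ~ vanishes_on p Z'.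
Proof.
case=> V [S ->] -> Z'A nsub; apply: contrapT => none; apply: nsub => x Z'x.
split; first exact: Z'A.
move=> p Sp; apply: contrapT => px; apply: none; exists p.
  by move=> y [_]; apply.
by move=> p0; apply/px/p0.
Qed.

(** This is where irreducibility makes dimension grow: functions independent on
    [Z] remain independent on the larger set [Z'] after multiplication by
    distinct powers of a function that vanishes on [Z] but not on [Z'], since
    the lowest power can be read off on [Z] and then cancelled on [Z']. *)
Lemma free_on_powers Z Z' (I : finType) (h : I -> {mpoly F[#|C|]}) p m :
  irreducible Z' -> (Z `<=` Z')%classic ->
  vanishes_on p Z -> ~ vanishes_on p Z' ->
  free_on Z (fun i => peval (h i)) ->
  free_on Z' (fun ik : I * 'I_m => peval (h ik.1 * p ^+ ik.2)).
Proof.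
move=> irrZ' ZZ' pZ pZ' freeh c c0 [i k].
pose d (i : I) (k : nat) : F := if insub k is Some k' then c (i, k') else 0.
have dE i' (k' : 'I_m) : d i' k' = c (i', k') by rewrite /d valK.
rewrite -dE; have := ltn_ord k; move: (nat_of_ord k) i.
have {c0}: vanishes_on (\sum_(k < m) \sum_i d i k *: (h i * p ^+ k)) Z'.
  move=> x Z'x; rewrite -[RHS](c0 x Z'x) pevalE /mev raddf_sum /=.
  under eq_bigr => k' _ do rewrite raddf_sum /=.
  rewrite exchange_big pair_bigA /=; apply: eq_bigr => -[i k'] _ /=.
  by rewrite mevalZ /d valK.
move: d {dE}; elim: m {k c} => [//|m IH] d d0.
have d00 i : d i 0%N = 0.
  apply: (freeh (d^~ 0%N)) => x Zx; have := d0 x (ZZ' x Zx).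
  rewrite big_ord_recl pevalE /mev mevalD !raddf_sum /= [X in _ + X]big1.
    by rewrite addr0 => d0x; rewrite -[RHS]d0x; apply: eq_bigr => i' _;
      rewrite mevalZ expr0 mulr1.
  move=> k _; rewrite raddf_sum /= big1 // => i' _.
  by rewrite mevalZ mevalM /= exprS mevalM [p.@[_]](pZ x Zx) mul0r !mulr0.
pose q := \sum_(k < m) \sum_i d i k.+1 *: (h i * p ^+ k).
have q0 : vanishes_on q Z'.
  case: (@irreducible_vanishes_mul Z' p q) => // x Z'x; rewrite -[RHS](d0 x Z'x).
  congr (peval _ x); rewrite big_ord_recl big1 ?add0r; last first.
    by move=> i _; rewrite d00 scale0r.
  rewrite /q big_distrr /=; apply: eq_bigr => k _.
  rewrite big_distrr /=; apply: eq_bigr => i _.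
  by rewrite -scalerAr mulrCA -exprS.
move=> [|k] ltk i; first exact: d00.
exact: (IH (fun i k => d i k.+1) q0 k ltk i).
Qed.

(** A chain of length [e] thus carries about [m ^ e] independent functions of
    degree [O(m)], the growth rate of polynomials in [e] variables. *)
Lemma chain_free_on A e (Z : nat -> set E) : irreducible_chain A e Z ->
  exists D, forall m, exists (I : finType) (h : I -> {mpoly F[#|C|]}),
    [/\ #|I| = (m ^ e)%N, forall i, (msize (h i) <= (D * m).+1)%N
      & free_on (Z e) (fun i => peval (h i))].
Proof.
elim: e => [|e IH] [clirr strict].
  exists 0%N => m; exists unit, (fun=> 1); split; first by rewrite card_unit.
    by move=> _; rewrite msize1.
  move=> c c0 []; have [_ [[x Zx] _]] := clirr 0%N (leqnn _).
  have := c0 x Zx; rewrite (big_pred1 tt) /=; last by case.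
  by rewrite pevalE /mev meval1 mulr1.
have /IH[D HD] : irreducible_chain A e Z.
  by split=> k lek; [apply/clirr/leqW|apply/strict/leqW].
have [cle irre] := clirr e (leqnSn e).
have [clS irrS] := clirr e.+1 (leqnn _).
have [sub nsub] := strict e (ltnSn e).
have [] := closed_in_separation cle _ nsub; first by case: clS => V _ -> x [].
move=> p pZ pZ'; exists (D + msize p)%N => m.
have [I [h [cardI sh freeh]]] := HD m.
exists (I * 'I_m)%type, (fun ik : I * 'I_m => h ik.1 * p ^+ ik.2); split.
- by rewrite card_prod card_ord cardI expnSr.
- move=> [i k] /=; rewrite mulnDl.
  apply: leq_trans (msizeM_leS (sh i) (msizeX_leS k (leqnSn _))) _.
  by rewrite ltnS leq_add2l leq_mul2l (ltnW (ltn_ord k)) orbT.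
- exact: (free_on_powers irrS sub pZ pZ' freeh).
Qed.

Lemma leq_of_expn_bound e d w0 c :
  (forall m, (0 < m)%N -> (m ^ e <= w0 * (c * m) ^ d)%N) -> (e <= d)%N.
Proof.
move=> H; rewrite leqNgt; apply/negP => lt_de.
pose m := (w0 * c ^ d).+1.
have := H m isT; rewrite expnMn mulnA leqNgt => /negP; apply.
apply: (@leq_trans (m ^ d.+1)); last by rewrite leq_pexp2l.
by rewrite expnS ltn_pmul2r ?expn_gt0 // ltnSn.
Qed.

(** Functions of degree [O(m)] on [A] pull back to polynomials of degree [O(m)]
    on finitely many copies of the space of functions [T -> F], where at most
    [O(m ^ #|T|)] of them are independent; [chain_free_on] provides [m ^ e]. *)
Lemma chain_length_le A (W T : finType) (Psi : W -> (T -> F) -> E) :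
  (forall s c, polyfun (fun t => entry (Psi s t) c)) ->
  (forall x, A x -> exists s t, x = Psi s t) ->
  forall e (Z : nat -> set E), irreducible_chain A e Z -> (e <= #|T|)%N.
Proof.
move=> Psip cover e Z chain.
have [D2 HD2] : exists D, forall s c, polydeg D (fun t => entry (Psi s t) c).
  have [] := @polydeg_bound F (W * C)%type T (fun sc t => entry (Psi sc.1 t) sc.2).
    by case=> s c; apply: Psip.
  by move=> D HD; exists D => s c; apply: (HD (s, c)).
have ZA x : Z e x -> A x.
  by case: chain => /(_ e (leqnn _)) [] [V _ ->] _ _ [].
have [D HD] := chain_free_on chain.
apply: (@leq_of_expn_bound _ _ #|W| (D2 * D).+1) => m m_gt0.
have [I [h [<- sh freeh]]] := HD m.
pose K := (D2 * (D * m))%N.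
have hp s i : polydeg K (fun t => peval (h i) (Psi s t)).
  exact: (polydeg_comp (HD2 s) (sh i)).
have [P HP] : exists P : W -> I -> {mpoly F[#|T|]}, forall s i,
    (msize (P s i) <= K.+1)%N /\ forall t, peval (h i) (Psi s t) = mev (P s i) t.
  have /choice [P HP] : forall si : W * I, exists p : {mpoly F[#|T|]},
      (msize p <= K.+1)%N /\
      forall t, peval (h si.2) (Psi si.1 t) = mev p t.
    by case=> s i; have [p] := hp s i; exists p.
  by exists (fun s i => P (s, i)) => s i; apply: (HP (s, i)).
pose J : finType := 'X_{1..#|T| < K.+1}.
pose g (j : W * J) (y : W * (T -> F)) : F :=
  if j.1 == y.1 then \prod_k y.2 (enum_val k) ^+ bmnm j.2 k else 0.
have: (#|I| <= #|{: W * J}|)%N.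
  apply: (@free_on_card_le F (W * (T -> F))%type (fun y => Z e (Psi y.1 y.2)) I _
    (fun i y => peval (h i) (Psi y.1 y.2)) g
    (fun i j => (P j.1 i)@_(bmnm j.2))).
    move=> i [s t] /=; have [sP ->] := HP s i.
    rewrite -(pair_big predT predT (fun a b =>
       (P a i)@_(bmnm b) * g (a, b) (s, t))) /=.
    rewrite (bigD1 s) //= [X in _ = _ + X]big1 ?addr0; last first.
      move=> s' /negbTE ns; rewrite big1 // => f _.
      by rewrite /g /= ns mulr0.
    rewrite /mev /meval (mmapE K.+1) //; apply: eq_bigr => f _.
    by rewrite /g /= eqxx.
  move=> c c0 i; apply: (freeh c) => x Zx.
  have [s [t xE]] := cover x (ZA x Zx).
  by have := c0 (s, t); rewrite /= -xE; apply.
move/leq_trans; apply; rewrite card_prod leq_mul2l; apply/orP; right.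
apply: leq_trans (card_bmultinom_le _ _) _.
suff ltK : (K.+1 <= (D2 * D).+1 * m)%N by case: #|T| => // d; rewrite leq_exp2r.
by rewrite /K mulSn addnC mulnA -[X in (X < _)%N]addn0 ltn_add2l.
Qed.

End Chains.

Lemma poly_nonroot (F : numFieldType) (q : {poly F}) :
  q != 0 -> exists s, q.[s] != 0.
Proof.
move=> qN0; apply: contrapT => none.
have root0 s : root q s by apply: contrapT => rs; apply: none; exists s; apply/negP.
have := @max_poly_roots F q [seq i%:R | i <- iota 0 (size q)] qN0.
rewrite size_map size_iota ltnn.
case: allP => [_|[] s _]; last exact: root0.
rewrite map_inj_uniq ?iota_uniq; first by move=> /(_ isT isT).
by move=> i j /eqP; rewrite eqr_nat => /eqP.
Qed.

(** Nonempty principal open subsets of a line meet. *)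
Lemma polyfun_prod_line_neq0 (F : numFieldType) (T : finType)
    (hs : seq ((T -> F) -> F)) (t u : T -> F) :
  (forall h, List.In h hs -> polyfun h /\
     exists s, h (fun x => t x + s * (u x - t x)) != 0) ->
  exists s, forall h, List.In h hs -> h (fun x => t x + s * (u x - t x)) != 0.
Proof.
move=> H.
suff [q qN0 qP] : exists2 q : {poly F}, q != 0 & forall s, q.[s] != 0 ->
    forall h, List.In h hs -> h (fun x => t x + s * (u x - t x)) != 0.
  by have [s /qP] := poly_nonroot qN0; exists s.
elim: hs H => [|h hs IH] H; first by exists 1; rewrite ?oner_eq0.
have [q qN0 qP] : exists2 q : {poly F}, q != 0 & forall s, q.[s] != 0 ->
    forall h, List.In h hs -> h (fun x => t x + s * (u x - t x)) != 0.
  by apply: IH => h' hh'; apply: H; right.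
have [hp [s hs0]] := H h (or_introl erefl).
have [r rP] := polyfun_line t u hp.
exists (r * q).
  rewrite mulf_neq0 //; apply: contra_neq hs0 => r0.
  by rewrite rP r0 horner0.
move=> s'; rewrite hornerM mulf_eq0 negb_or => /andP[rs qs] h' /= [<-|].
  by rewrite rP.
exact: qP.
Qed.

(** * Chains of closures of images *)

Section ChainOfImages.
Variables (F : numFieldType) (n : nat) (w : 'I_n -> nat).
Local Notation E := (repSpace F w).
Local Notation C := (Defs.coord w).
Variables (A : set E) (T : finType) (Phi : (T -> F) -> E) (g : (T -> F) -> F).
Variables (b : T -> F) (key : T -> nat).
Hypothesis Phi_poly : forall c, polyfun (fun t => entry (Phi t) c).
Hypothesis g_poly : polyfun g.
Hypothesis g_b : g b != 0.
Hypothesis PhiA : forall t, g t != 0 -> A (Phi t).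
(** [key] tells in which order the parameters are freed; [x] can be read off the
    image as long as the parameters with a larger key are still equal to [b]. *)
Hypothesis detect : forall x, exists c, forall t,
  (forall y, (key x < key y)%N -> t y = b y) -> entry (Phi t) c = t x.

Let ordered := sort (relpre key leq) (enum T).
Let rank x := index x ordered.

Let mem_ordered x : x \in ordered.
Proof. by rewrite mem_sort mem_enum. Qed.

Let size_ordered : size ordered = #|T|.
Proof. by rewrite size_sort -cardE. Qed.

Let rank_key x y : (key x < key y)%N -> (rank x < rank y)%N.
Proof.
move=> ltxy; rewrite ltnNge leq_eqVlt; apply/negP => /orP[/eqP e|lt_yx].
  have exy : x = y by rewrite -(nth_index x (mem_ordered x)) -/(rank x) -e nth_index.
  by rewrite exy ltnn in ltxy.
have tr : transitive (relpre key leq) by move=> ? ? ?; apply: leq_trans.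
have so : sorted (relpre key leq) ordered.
  by apply: sort_sorted => ? ?; apply: leq_total.
have := sorted_ltn_index tr so y x (mem_ordered y) (mem_ordered x) lt_yx.
by rewrite /= leqNgt ltxy.
Qed.

Let slice k (t : T -> F) : Prop := forall x, (k <= rank x)%N -> t x = b x.

(** The closure, in [A], of the image of the slice where only the first [k]
    parameters are free. *)
Let stage k : set E := (A `&`
  [set x | forall p, (forall t, slice k t -> g t != 0 -> peval p (Phi t) = 0) ->
     peval p x = 0])%classic.

Let stage_Phi k t : slice k t -> g t != 0 -> stage k (Phi t).
Proof. by move=> st gt; split; [apply: PhiA|move=> p; apply]. Qed.

Let peval_Phi_poly p : polyfun (fun t => peval p (Phi t)).
Proof. exact: (polyfun_comp (h := fun c t => entry (Phi t) c)). Qed.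

Let stage_closed k : closed_in A (stage k).
Proof.
exists [set x | forall p, (forall t, slice k t -> g t != 0 -> peval p (Phi t) = 0) ->
  peval p x = 0]%classic => //.
by exists [set p | forall t, slice k t -> g t != 0 -> peval p (Phi t) = 0]%classic.
Qed.

Let slice_line k t u s : slice k t -> slice k u ->
  slice k (fun x => t x + s * (u x - t x)).
Proof. by move=> st su x kx; rewrite st // su // subrr mulr0 addr0. Qed.

(** Two nonzero polynomials on a slice, and [g], are nonzero together somewhere
    on the line through a point of each; so their product is nonzero. *)
Let stage_irreducible k : irreducible (stage k).
Proof.
split; first by exists (Phi b); apply: stage_Phi.
move=> Z1 Z2 [V1 [S1 ->] Z1E] [V2 [S2 ->] Z2E] ZU.
(* A proper closed part of [stage k] misses some [Phi t] with [t] in the slice. *)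
have proper S Z : Z = (stage k `&` [set x | forall p, S p -> peval p x = 0])%classic ->
    stage k <> Z -> exists p t, [/\ S p, slice k t, g t != 0 & peval p (Phi t) != 0].
  move=> ZE neq; apply: contrapT => none; apply: neq.
  rewrite ZE; apply/seteqP; split=> [x stx|x []//]; split=> // p Sp.
  case: stx => _; apply=> t st gt; apply/eqP/negPn/negP => pt.
  by apply: none; exists p, t.
apply: contrapT => /not_orP[n1 n2].
have [p1 [t1 [Sp1 st1 gt1 pt1]]] := proper _ _ Z1E n1.
have [p2 [t2 [Sp2 st2 gt2 pt2]]] := proper _ _ Z2E n2.
have [s H] : exists s, forall h,
    List.In h [:: g; (fun t => peval p1 (Phi t)); (fun t => peval p2 (Phi t))] ->
    h (fun x => t1 x + s * (t2 x - t1 x)) != 0.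
  have line0 : (fun x => t1 x + 0 * (t2 x - t1 x)) = t1.
    by apply/funext => x; rewrite mul0r addr0.
  have line1 : (fun x => t1 x + 1 * (t2 x - t1 x)) = t2.
    by apply/funext => x; rewrite mul1r addrC subrK.
  apply: polyfun_prod_line_neq0 => h /= [|[|[|//]]] <-; split=> //.
  - by exists 0; rewrite line0.
  - by exists 0; rewrite line0.
  - by exists 1; rewrite line1.
pose t x := t1 x + s * (t2 x - t1 x).
have gt : g t != 0 by apply: H; left.
have : stage k (Phi t) by apply: stage_Phi => //; apply: slice_line.
rewrite ZU Z1E Z2E => -[] [_ /= V].
- have /eqP[] : peval p1 (Phi t) != 0.
    by apply: (H (fun t => peval p1 (Phi t))); right; left.
  exact: V.
- have /eqP[] : peval p2 (Phi t) != 0.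
    by apply: (H (fun t => peval p2 (Phi t))); right; right; left.
  exact: V.
Qed.

(** The coordinate that detects the [k]-th parameter is constant on [stage k],
    but takes another value on a line through [b] inside the next slice. *)
Let stage_strict k : (k < #|T|)%N -> (stage k `<` stage k.+1)%classic.
Proof.
move=> ltk; split.
  move=> x [Ax Vx]; split=> // p p0; apply: Vx => t st gt; apply: p0 => // y ky.
  by apply: st; apply: ltnW.
have [x0 _] : exists x0 : T, x0 \in T by apply/card_gt0P; apply: leq_ltn_trans ltk.
pose x := nth x0 ordered k.
have rx : rank x = k.
  by rewrite /rank index_uniq ?size_ordered // sort_uniq enum_uniq.
have [c xc] := detect x.
pose p : {mpoly F[#|C|]} := 'X_(enum_rank c) - (b x)%:MP.
have pE y : peval p y = entry y c - b x.
  by rewrite pevalE /mev mevalB mevalXU mevalC enum_rankK.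
have later t m : slice m t -> (m <= k.+1)%N -> entry (Phi t) c = t x.
  move=> st mk; apply: xc => y /rank_key; rewrite rx => ry.
  by apply: st; apply: leq_trans mk ry.
pose u y := if y == x then b y + 1 else b y.
have [s H] : exists s, forall h, List.In h [:: g; (fun t => t x - b x)] ->
    h (fun y => b y + s * (u y - b y)) != 0.
  apply: polyfun_prod_line_neq0 => h /= [|[|//]] <-; split=> //.
  - exists 0; rewrite (_ : (fun _ => _) = b) //.
    by apply/funext => y; rewrite mul0r addr0.
  - exact: polyfunD (polyfun_var _ _) (polyfunC _ _).
  - exists 1; rewrite /u eqxx [b x + 1]addrC addrK mul1r.
    by rewrite [X in X - _]addrC addrK oner_eq0.
pose t y := b y + s * (u y - b y).
have gt : g t != 0 by apply: H; left.
have /negP tx : t x - b x != 0 by apply: (H (fun t => t x - b x)); right; left.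
have st : slice k.+1 t.
  move=> y ky; rewrite /t /u; case: eqP => [yx|_]; last by rewrite subrr mulr0 addr0.
  by rewrite yx rx ltnn in ky.
move=> /(_ _ (stage_Phi st gt)) [_ /(_ p)]; rewrite pE (later _ _ st) //.
move=> e; apply: tx; apply/eqP/e => t' st' _.
by rewrite pE (later _ _ st') // st' ?rx // subrr.
Qed.

Lemma chain_of_images : exists Z : nat -> set E, irreducible_chain A #|T| Z.
Proof. by exists stage; split=> k kT; [split|apply: stage_strict]. Qed.

End ChainOfImages.

(** * Matrices that are block triangular for a level function *)

Lemma invmx_mulmx (F : fieldType) m (A B : 'M[F]_m) :
  A \in unitmx -> B \in unitmx -> invmx (A *m B) = invmx B *m invmx A.
Proof.
move=> AU BU; have ABU : A *m B \in unitmx by rewrite unitmx_mul AU.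
apply: (can_inj (mulKmx ABU)).
by rewrite mulmxV // mulmxA mulmxK // mulmxV.
Qed.

Section SupportedInverse.
Variables (F : fieldType) (m : nat) (r : rel 'I_m).
Hypotheses (r_refl : reflexive r) (r_tr : transitive r).

(** For every [i] the span of the basis row vectors [e_j] with [r i j] is stable
    under [p], hence by rank equal to its image, hence stable under the inverse
    of [p]. *)
Lemma invmx_supported (p : 'M[F]_m) : p \in unitmx ->
  (forall i j, ~~ r i j -> p i j = 0) ->
  forall i j, ~~ r i j -> invmx p i j = 0.
Proof.
move=> pU p0 i j nrij.
pose V : 'M[F]_m := diag_mx (\row_k (r i k)%:R).
have VpV : V *m p = (V *m p) *m V.
  apply/matrixP => a b; rewrite mul_mx_diag mul_diag_mx !mxE.
  have [ria|] := boolP (r i a); last by rewrite !mul0r.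
  have [rib|nrib] := boolP (r i b); first by rewrite mulr1.
  rewrite p0 ?mulr0 ?mul0r //; apply: contra nrib; exact: r_tr.
have sub : (V *m p <= V)%MS by rewrite VpV submxMl.
have : (V <= V *m p)%MS.
  by rewrite -(geq_leqif (mxrank_leqif_sup sub)) mxrankMfree ?row_free_unit.
case/submxP=> D /(congr1 (mulmx^~ (invmx p))).
rewrite -mulmxA -mulmxA mulmxV // mulmx1 => /matrixP /(_ i j).
rewrite mul_diag_mx mul_mx_diag !mxE r_refl mul1r => ->.
by rewrite (negbTE nrij) mulr0.
Qed.

End SupportedInverse.

Section Shapes.
Variables (F : fieldType).

(** In these shapes [l], [lr] and [lc] give the blocks of the row and column
    indices. *)
Definition low_unipotent m (l : 'I_m -> nat) (v : 'M[F]_m) : Prop :=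
  forall i j, (l i <= l j)%N -> v i j = (i == j)%:R.

Definition up_triangular m (l : 'I_m -> nat) (p : 'M[F]_m) : Prop :=
  forall i j, (l j < l i)%N -> p i j = 0.

Definition strictly_up m q (lr : 'I_m -> nat) (lc : 'I_q -> nat)
    (x : 'M[F]_(m, q)) : Prop :=
  forall i j, (lc j <= lr i)%N -> x i j = 0.

Lemma low_unipotent_invmx m (l : 'I_m -> nat) (v : 'M[F]_m) :
  v \in unitmx -> low_unipotent l v -> low_unipotent l (invmx v).
Proof.
move=> vU vl.
pose r := [rel i j : 'I_m | (i == j) || (l j < l i)%N].
have rr : reflexive r by move=> i; rewrite /= eqxx.
have rt : transitive r.
  move=> y x z /= /orP[/eqP->//|lyx] /orP[/eqP<-|lzy]; rewrite ?lyx ?orbT //.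
  by rewrite (ltn_trans lzy lyx) orbT.
have vr i j : ~~ r i j -> v i j = 0.
  by rewrite /= negb_or -leqNgt => /andP[/negbTE nij lij]; rewrite vl // nij.
have inv0 := invmx_supported rr rt vU vr.
move=> i j lij; have [<-|nij] := eqVneq i j; last first.
  by rewrite inv0 //= negb_or nij -leqNgt.
have /matrixP /(_ i i) := mulVmx vU; rewrite !mxE eqxx (bigD1 i) //=.
rewrite (vl i i) // eqxx mulr1 big1 ?addr0 // => k ki.
have [lki|lik] := leqP (l k) (l i).
  by rewrite (vl k i) // (negbTE ki) mulr0.
by rewrite inv0 ?mul0r //= negb_or eq_sym ki -leqNgt ltnW.
Qed.

Lemma low_unipotent_det m (l : 'I_m -> nat) (v : 'M[F]_m) :
  {homo l : i j / (i <= j)%N} -> low_unipotent l v -> \det v = 1.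
Proof.
move=> lh vl; rewrite det_trig; last first.
  apply/is_trig_mxP => i j ltij; rewrite vl; last exact/lh/ltnW.
  by rewrite -val_eqE /= ltn_eqF.
by rewrite big1 // => i _; rewrite vl // eqxx.
Qed.

Lemma up_triangular_invmx m (l : 'I_m -> nat) (p : 'M[F]_m) :
  p \in unitmx -> up_triangular l p -> up_triangular l (invmx p).
Proof.
move=> pU pl i j lij; apply: (@invmx_supported _ _ [rel a b | (l a <= l b)%N]) => //=.
- by move=> ?; apply: leqnn.
- by move=> ? ? ?; apply: leq_trans.
- by move=> a b; rewrite -ltnNge; apply: pl.
- by rewrite -ltnNge.
Qed.

Lemma strictly_up_mulr m q lr lc (x : 'M[F]_(m, q)) p :
  strictly_up lr lc x -> up_triangular lc p -> strictly_up lr lc (x *m p).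
Proof.
move=> xs pu i j lij; rewrite mxE big1 // => k _.
have [/xs->|ltik] := leqP (lc k) (lr i); first by rewrite mul0r.
by rewrite pu ?mulr0 //; apply: leq_ltn_trans ltik.
Qed.

Lemma strictly_up_mull m q lr lc (x : 'M[F]_(m, q)) p :
  strictly_up lr lc x -> up_triangular lr p -> strictly_up lr lc (p *m x).
Proof.
move=> xs pu i j lij; rewrite mxE big1 // => k _.
have [/pu->|ltik] := ltnP (lr k) (lr i); first by rewrite mul0r.
by rewrite xs ?mulr0 //; apply: leq_trans ltik.
Qed.

(** Up to a row permutation every invertible matrix lies in the big cell: the
    block diagonal part of the unitriangular factor of an LU decomposition is
    moved into the other factor. *)
Lemma big_cell_decomposition m (l : 'I_m -> nat) (g : 'M[F]_m) :
  {homo l : i j / (i <= j)%N} -> g \in unitmx ->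
  exists (s : 'S_m) (v p : 'M[F]_m),
    [/\ low_unipotent l v, up_triangular l p & g = perm_mx s *m v *m p].
Proof.
case: m l g => [|m] l g lh gU.
  by exists 1%g, g, g; split=> [[]|[]|] //; apply/matrixP => -[].
have := cormen_lup_perm g; have := cormen_lup_correct g.
have := @cormen_lup_lower _ _ g; have := @cormen_lup_upper _ _ g.
case: (cormen_lup g) => [[P L] U] /= Uup Llow PLU /is_perm_mxP[s Ps].
rewrite {}Ps in PLU.
pose D : 'M[F]_m.+1 := \matrix_(i, j) (if l i == l j then L i j else 0).
have Dtri (i j : 'I_m.+1) : (i < j)%N -> D i j = 0.
  move=> ltij; rewrite mxE Llow ?(ltnW ltij) // -[i == j]val_eqE /=.
  by rewrite (ltn_eqF ltij) if_same.
have Dii i : D i i = 1 by rewrite mxE eqxx Llow // eqxx.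
have DU : D \in unitmx.
  rewrite unitmxE det_trig; last by apply/is_trig_mxP.
  by rewrite big1 ?unitr1.
have iD0 i j : l i != l j -> invmx D i j = 0.
  apply: (@invmx_supported _ _ [rel a b | l a == l b]) => //=.
  - by move=> ?; apply: eqxx.
  - by move=> ? ? ? /= /eqP->.
  - by move=> a b /negbTE nab; rewrite mxE nab.
exists s^-1%g, (L *m invmx D), (D *m U); split.
- move=> i j lij.
  (* [L - D] sits strictly below the diagonal blocks. *)
  have -> : L *m invmx D = 1%:M + (L - D) *m invmx D.
    by rewrite mulmxBl mulmxV // addrC subrK.
  rewrite !mxE big1 ?addr0 // => k _.
  have [lkj|/iD0->] := eqVneq (l k) (l j); last by rewrite mulr0.
  rewrite !mxE; case: eqP => [_|/eqP nik]; first by rewrite subrr mul0r.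
  rewrite Llow; last first.
    rewrite leqNgt; apply/negP => /ltnW /lh; rewrite leq_eqVlt => /orP[/eqP e|].
      by rewrite e eqxx in nik.
    by rewrite lkj ltnNge lij.
  case: eqP => [e|_]; first by rewrite e eqxx in nik.
  by rewrite subr0 mul0r.
- move=> i j lji; rewrite mxE big1 // => k _.
  have [lik|nlik] := eqVneq (l i) (l k); last by rewrite mxE (negbTE nlik) mul0r.
  rewrite Uup ?mulr0 // ltnNge; apply/negP => /lh.
  by rewrite -lik leqNgt lji.
- rewrite -mulmxA [L *m _ *m _]mulmxA mulmxKV //.
  have -> : L *m U = perm_mx s *m g by rewrite -[L *m U]/(L * U) -PLU.
  by rewrite mulmxA -perm_mxM mulVg perm_mx1 mul1mx.
Qed.

End Shapes.

(** * Representations with a basis permuted by the arrows *)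

Section Isomorphisms.
Variables (F : fieldType) (n : nat).
Implicit Types M N : quiverRep F n.

Lemma rep_iso_sym M N : rep_iso M N -> rep_iso N M.
Proof.
case=> phi [psi [pK Kp com]]; exists psi, phi; split=> // a.
rewrite -[LHS]mulmx1 -(Kp (src a)) mulmxA -[X in X *m _]mulmxA -com.
by rewrite !mulmxA pK mul1mx.
Qed.

Lemma rep_iso_trans M N K : rep_iso M N -> rep_iso N K -> rep_iso M K.
Proof.
case=> f [f' [fK Kf fc]] [g [g' [gK Kg gc]]].
exists (fun v => g v *m f v), (fun v => f' v *m g' v); split=> [v|v|a].
- by rewrite mulmxA -[_ *m g v]mulmxA gK mulmx1.
- by rewrite mulmxA -[_ *m f' v]mulmxA Kf mulmx1.
- by rewrite -mulmxA fc mulmxA gc mulmxA.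
Qed.

End Isomorphisms.

Section LabelledBases.
Variables (F : fieldType) (n : nat).
Implicit Types (M N : quiverRep F n) (P Q : 'I_n -> pred (nat * nat)).

(** A combinatorial description of [M] up to isomorphism: every arrow sends each
    basis vector to the one with the same label, or to [0] if there is none, and
    [P v] is the set of labels in use at [v]. If each label is in use on an
    interval of vertices, these intervals are the summands of [M]. *)
Definition labelled M P : Prop :=
  exists b : forall v, 'I_(rdim M v) -> nat * nat,
    [/\ forall v, injective (b v),
        forall v k, P v k <-> exists i, b v i = k
      & forall a r c, rmap M a r c = (b (tgt a) r == b (src a) c)%:R].

Lemma sum_label m (b : 'I_m -> nat * nat) (f : 'I_m -> F) k0 :
  injective b -> \sum_k (b k0 == b k)%:R * f k = f k0.
Proof.
move=> bI; rewrite (bigD1 k0) //= eqxx mul1r big1 ?addr0 // => k kk0.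
by rewrite (inj_eq bI) eq_sym (negbTE kk0) mul0r.
Qed.

(** The isomorphism matches the basis vectors with equal labels. *)
Lemma labelled_iso M N P : labelled M P -> labelled N P -> rep_iso M N.
Proof.
move=> [b [bI bP bM]] [c [cI cP cN]].
have bc v i : exists j, c v j = b v i by apply/cP/bP; exists i.
have cb v i : exists j, b v j = c v i by apply/bP/cP; exists i.
exists (fun v => \matrix_(i, j) (c v i == b v j)%:R),
  (fun v => \matrix_(i, j) (b v i == c v j)%:R).
split=> [v|v|a]; apply/matrixP => i j; rewrite !mxE.
- have [k ek] := bc v i; under eq_bigr => l _ do rewrite !mxE -ek.
  by rewrite sum_label // ek (inj_eq (bI v)).
- have [k ek] := cb v i; under eq_bigr => l _ do rewrite !mxE -ek.
  by rewrite sum_label // ek (inj_eq (cI v)).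
- have [k ek] := cb (tgt a) i; have [l el] := bc (src a) j.
  under eq_bigr => k' _ do rewrite !mxE bM -ek.
  rewrite sum_label // ek -el.
  under eq_bigr => k' _ do rewrite !mxE cN mulrC -el [c _ k' == _]eq_sym.
  by rewrite sum_label.
Qed.

Lemma eq_labelled M P Q : (forall v, P v =1 Q v) -> labelled M P -> labelled M Q.
Proof.
by move=> PQ [b [bI bP bM]]; exists b; split=> // v k; rewrite -PQ.
Qed.

Lemma labelled_rep0 : labelled (rep0 F n) (fun _ _ => false).
Proof.
exists (fun _ _ => (0%N, 0%N)); split=> [v []|v k|a []] //.
by split=> // -[[]].
Qed.

Lemma labelled_intervalRep i j k0 :
  labelled (intervalRep F n i j) (fun v k => (i <= v <= j)%N && (k == k0)).
Proof.
exists (fun _ _ => k0); split=> [v|v k|a r c] /=; last by rewrite mxE eqxx.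
  by case: (_ && _) => -[[|x] xP] [[|y] yP] // _; apply: val_inj.
split=> [/andP[ivj /eqP->]|[[x xP] <-]]; last by rewrite eqxx andbT; case: (_ && _) xP.
by rewrite ivj; exists ord0.
Qed.

Lemma labelled_dsum M N P Q :
  (forall v v' k, P v k -> Q v' k -> False) ->
  labelled M P -> labelled N Q ->
  labelled (dsum M N) (fun v k => P v k || Q v k).
Proof.
move=> disj [b [bI bP bM]] [c [cI cQ cN]].
have bcF v v' i j : (b v i == c v' j) = false.
  by apply/eqP => e; apply: (disj v v' (b v i)); [apply/bP; exists i|apply/cQ; exists j].
exists (fun v i => match split i with inl i => b v i | inr j => c v j end).
split=> [v i j|v k|a r s] /=.
- move=> e; rewrite -(splitK i) -(splitK j); move: e.
  case: (split i) (split j) => [i'|i'] [j'|j'] e /=.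
  + by rewrite (bI _ _ _ e).
  + by move/eqP: e; rewrite bcF.
  + by move/esym/eqP: e; rewrite bcF.
  + by rewrite (cI _ _ _ e).
- split=> [/orP[/bP[i <-]|/cQ[i <-]]|[i <-]].
  + by exists (lshift _ i); rewrite (unsplitK (inl i)).
  + by exists (rshift _ i); rewrite (unsplitK (inr i)).
  + case: (split i) => j; apply/orP; [left; apply/bP|right; apply/cQ]; by exists j.
- rewrite !mxE; case: (split r) => r'; rewrite !mxE; case: (split s) => s'.
  + exact: bM.
  + by rewrite mxE bcF.
  + by rewrite mxE eq_sym bcF.
  + exact: cN.
Qed.

Lemma labelled_big (I : eqType) (r : seq I) (M : I -> quiverRep F n)
    (P : I -> 'I_n -> pred (nat * nat)) :
  uniq r -> (forall i, i \in r -> labelled (M i) (P i)) ->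
  (forall i i' v v' k, i \in r -> i' \in r -> P i v k -> P i' v' k -> i = i') ->
  labelled (\big[@dsum F n/rep0 F n]_(i <- r) M i)
    (fun v k => has (fun i => P i v k) r).
Proof.
elim: r => [|i r IH] /=; first by rewrite big_nil => *; apply: labelled_rep0.
move=> /andP[ir ur] HM disj; rewrite big_cons; apply: labelled_dsum.
- move=> v v' k Pik /hasP[i' i'r Pi'k]; move: ir.
  by rewrite (disj i i' v v' k) ?i'r // inE ?eqxx ?i'r ?orbT.
- by apply: HM; rewrite mem_head.
- apply: IH => // [i' i'r|i1 i2 v v' k r1 r2].
    by apply: HM; rewrite inE i'r orbT.
  by apply: disj; rewrite inE ?r1 ?r2 orbT.
Qed.

End LabelledBases.

Section ArrayRepresentation.
Variables (F : fieldType) (n : nat) (Y : nat -> nat -> nat).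
Hypothesis Ymono : forall i j, (i.+1 < n)%N -> (j < n - i.+1)%N ->
  (Y i j.+1 <= Y i.+1 j)%N.

Let off i e : nat := if i is i'.+1 then Y i' (e - i).+1 else 0.

Let offS i e : (i < e)%N -> off i.+1 e = Y i (e - i).
Proof. by move=> lt_ie /=; rewrite subnSK. Qed.

Let off_le i e : (i <= e)%N -> (e < n)%N -> (off i e <= Y i (e - i))%N.
Proof. by case: i => [|i] // le_ie lt_en; apply: Ymono; lia. Qed.

Let Y_le i i' e : (i <= i')%N -> (i' <= e)%N -> (e < n)%N ->
  (Y i (e - i) <= Y i' (e - i'))%N.
Proof.
elim: i' => [|i' IH]; first by case: i.
rewrite leq_eqVlt => /orP[/eqP-> //|le_ii' lt_i'e lt_en].
apply: leq_trans (IH le_ii' (ltnW lt_i'e) lt_en) _.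
by rewrite -offS //; apply: off_le.
Qed.

(** The labels of the strings through [v]: a string [(e, m)] ends at the vertex
    [e], and [m] tells it apart from the others that end there. *)
Definition string_at (v : 'I_n) (k : nat * nat) : bool :=
  (v <= k.1 < n)%N && (k.2 < Y v (k.1 - v))%N.

(** Strings ending at the vertex [e] are numbered so that those starting at or
    before [v] get the labels [(e, m)] with [m < Y v (e - v)]; the copies of the
    interval [[i, e]] come after all strings that start before [i]. *)
Lemma labelled_rep_of_array : labelled (rep_of_array F n Y) string_at.
Proof.
pose P3 i j (m : nat) (v : 'I_n) (k : nat * nat) :=
  (i <= v <= j)%N && (k == (j, off i j + m)%N).
pose P2 i j (v : 'I_n) (k : nat * nat) :=
  [&& (i <= v <= j)%N, k.1 == j & (off i j <= k.2 < Y i (j - i))%N].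
pose P1 i (v : 'I_n) (k : nat * nat) :=
  [&& (i <= v <= k.1)%N, (k.1 < n)%N & (off i k.1 <= k.2 < Y i (k.1 - i))%N].
have L2 i j : (i <= j)%N -> (j < n)%N ->
    labelled (\big[@dsum F n/rep0 F n]_(0 <= m < nu Y i j) intervalRep F n i j) (P2 i j).
  move=> le_ij lt_jn.
  apply: eq_labelled (labelled_big (P := P3 i j) _ _ _).
  - move=> v [e q]; rewrite /P2 /P3 /=.
    have := off_le le_ij lt_jn; rewrite /nu -/(off i j) => le_off.
    apply/hasP/and3P => [[m]|[ivj /eqP-> qP]].
      by rewrite mem_index_iota => mP /andP[-> /eqP[-> ->]]; split=> //; lia.
    exists (q - off i j)%N; first by rewrite mem_index_iota; lia.
    by rewrite ivj; apply/eqP; congr pair; lia.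
  - exact: iota_uniq.
  - by move=> m _; apply: labelled_intervalRep.
  - by move=> m m' v v' k _ _ /andP[_ /eqP->] /andP[_ /eqP[]]; lia.
have L1 i : (i < n)%N ->
    labelled (\big[@dsum F n/rep0 F n]_(i <= j < n)
      \big[@dsum F n/rep0 F n]_(0 <= m < nu Y i j) intervalRep F n i j) (P1 i).
  move=> lt_in.
  apply: eq_labelled (labelled_big (P := P2 i) _ _ _).
  - move=> v [e q]; rewrite /P2 /P1 /=; apply/hasP/and3P => [[j]|[ive len qP]].
      by rewrite mem_index_iota => /andP[_ ltjn] /and3P[? /eqP->].
    exists e; first by rewrite mem_index_iota; lia.
    by rewrite ive eqxx.
  - exact: iota_uniq.
  - by move=> j; rewrite mem_index_iota => /andP[? ?]; apply: L2.
  - by move=> j j' v v' k _ _ /and3P[_ /eqP<- _] /and3P[_ /eqP->].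
apply: eq_labelled (labelled_big (P := P1) _ _ _).
- move=> v [e q]; rewrite /P1 /string_at /=; apply/hasP/andP.
    move=> [i _ /and3P[/andP[le_iv le_ve] lt_en /andP[_ qP]]].
    by split; [lia|apply: leq_trans qP _; apply: Y_le].
  move=> [/andP[le_ve lt_en] qP].
  have ex : exists i, (i <= v)%N && (q < Y i (e - i))%N by exists v; rewrite leqnn.
  case: (ex_minnP ex) => i /andP[le_iv qi] imin.
  exists i; first by rewrite mem_index_iota; have := ltn_ord v; lia.
  rewrite le_iv le_ve lt_en qi !andbT /=.
  case: i le_iv imin {qi} => [|i] le_iv imin //.
  rewrite leqNgt offS; last by lia.
  by apply/negP => qi; have := imin i; rewrite qi (ltnW le_iv) ltnn => /(_ isT).
- exact: iota_uniq.
- by move=> i; rewrite mem_index_iota => /andP[_ ?]; apply: L1.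
- move=> i i' v v' [e q] _ _.
  wlog lt_ii' : i i' v v' / (i < i')%N.
    move=> H h h'; case: (ltngtP i i') => // lt_ii'; first exact: H h h'.
    by apply/esym; apply: H h' h.
  rewrite /P1 /= => /and3P[/andP[_ _] lt_en /andP[_ qY]].
  move=> /and3P[/andP[le1 le2] _ /andP[offq _]].
  case: i' lt_ii' le1 offq => // i' lt_ii' le1; rewrite offS; last by lia.
  by have := @Y_le i i' e; lia.
Qed.

End ArrayRepresentation.

(** * Levels and labels *)

Section Levels.
Variables (n : nat) (w : 'I_n -> nat) (Y : nat -> nat -> nat).
Hypothesis PY : triangular_arrays w Y.

Definition blocks (v : nat) : seq nat := mkseq (Y v) (n - v).
Definition lev (v i : nat) : nat := reshape_index (blocks v) i.
Definition pos (v i : nat) : nat := reshape_offset (blocks v) i.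
Definition lab (v : 'I_n) (i : 'I_(w v)) : nat * nat := ((v + lev v i)%N, pos v i).

Lemma Y_arrow i j : (i.+1 < n)%N -> (j < n - i.+1)%N -> (Y i j.+1 <= Y i.+1 j)%N.
Proof. by case: PY => _; apply. Qed.

Lemma sumn_blocks (v : 'I_n) : sumn (blocks v) = w v.
Proof. by case: PY => <- _; rewrite sumnE big_map -{1}[(n - v)%N]subn0 big_mkord. Qed.

Lemma lev_lt (v : 'I_n) (i : 'I_(w v)) : (lev v i < n - v)%N.
Proof.
by have := @reshape_indexP (blocks v) i; rewrite size_mkseq sumn_blocks; apply.
Qed.

Lemma pos_lt (v : 'I_n) (i : 'I_(w v)) : (pos v i < Y v (lev v i))%N.
Proof.
have := @reshape_offsetP (blocks v) i; rewrite sumn_blocks => /(_ (ltn_ord i)).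
by rewrite nth_mkseq //; apply: lev_lt.
Qed.

Lemma lev_pos_surj (v : 'I_n) l m : (l < n - v)%N -> (m < Y v l)%N ->
  exists i : 'I_(w v), lev v i = l /\ pos v i = m.
Proof.
move=> ltl ltm; have ltm' : (m < nth 0 (blocks v) l)%N by rewrite nth_mkseq.
have := flatten_indexP ltm'; rewrite sumn_blocks => lti.
by exists (Ordinal lti); rewrite /lev /pos /= flatten_indexKl // flatten_indexKr.
Qed.

Lemma lev_pos_inj (v : nat) i j : lev v i = lev v j -> pos v i = pos v j -> i = j.
Proof.
move=> el ep; rewrite -(reshape_indexK (blocks v) i) -(reshape_indexK (blocks v) j).
by rewrite -/(lev v i) -/(pos v i) el ep.
Qed.

Lemma lev_homo (v : 'I_n) :
  {homo (fun i : 'I_(w v) => lev v i) : i j / (i <= j)%N}.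
Proof.
move=> i j; rewrite (reshape_leq (blocks v)) => /orP[/ltnW //|/andP[/eqP e _]].
by rewrite /lev e.
Qed.

Lemma lab_inj v : injective (@lab v).
Proof.
move=> i j [/addnI el ep]; apply: val_inj; exact: (lev_pos_inj el ep).
Qed.

Lemma labP v k : string_at Y v k <-> exists i, lab (v := v) i = k.
Proof.
case: k => e m; split=> [/andP[/andP[/= le_ve lt_en] lt_m]|[i [<- <-]]].
  have [|i [il ip]] := lev_pos_surj (v := v) _ lt_m; first by have := ltn_ord v; lia.
  by exists i; rewrite /lab il ip subnKC.
rewrite /string_at /= addKn pos_lt andbT leq_addr /=.
by have := lev_lt i; have := ltn_ord v; lia.
Qed.

(** A string that ends at [e] has level [e - v] at the vertex [v]. *)
Lemma lab_arrow (a : 'I_n.-1) (r : 'I_(w (tgt a))) (c : 'I_(w (src a))) :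
  lab r = lab c -> lev (src a) c = (lev (tgt a) r).+1.
Proof. by case; rewrite /= addSnnS => /addnI. Qed.

(** The inequalities that define triangular arrays say that each block is at
    least as large as the block one level up at the previous vertex, so that
    only vectors of level [0] are at the end of their string. *)
Lemma lab_next (a : 'I_n.-1) (c : 'I_(w (src a))) :
  (0 < lev (src a) c)%N -> exists r : 'I_(w (tgt a)), lab r = lab c.
Proof.
move=> lc; apply/labP; rewrite /string_at /=.
have := lev_lt c; have := pos_lt c => /=.
case: (lev a c) lc => // l _ ltp ltl; rewrite -addSnnS leq_addr addKn /=.
have lta := ltn_ord a; apply/andP; split; first by lia.
by apply: leq_trans ltp _; apply: Y_arrow; lia.
Qed.

Lemma sum_lev (v : 'I_n) (f : nat -> nat) :
  (\sum_(i < w v) f (lev v i) = \sum_(l < n - v) Y v l * f l)%N.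
Proof.
rewrite (partition_big (fun i : 'I_(w v) => Ordinal (lev_lt i)) predT) //=.
apply: eq_bigr => l _.
rewrite (eq_bigr (fun=> f l)); last by move=> i /eqP <-.
rewrite sum_nat_const; congr (_ * _)%N.
have /fin_all_exists[h hP] : forall m : 'I_(Y v l), exists i : 'I_(w v),
    lev v i = l /\ pos v i = m.
  by move=> m; apply: lev_pos_surj; rewrite ltn_ord.
have hI : injective h.
  move=> m m' e; apply: val_inj => /=.
  by have [_ <-] := hP m; have [_ <-] := hP m'; rewrite e.
rewrite -[RHS]card_ord -cardsT -(card_imset _ hI) -cardsE; apply: eq_card => i.
rewrite !inE; apply/eqP/imsetP => [e|[m _ ->]]; last first.
  by have [] := hP m.
have lil : lev v i = l by rewrite -e.
have ltp : (pos v i < Y v l)%N by rewrite -lil pos_lt.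
exists (Ordinal ltp) => //; apply: val_inj; have [le pe] := hP (Ordinal ltp).
by apply: (@lev_pos_inj v); rewrite ?le ?pe.
Qed.

End Levels.

(** * The orbit of the base point *)

Section Orbit.
Variables (F : fieldType) (n : nat) (w : 'I_n -> nat) (Y : nat -> nat -> nat).
Hypothesis PY : triangular_arrays w Y.
Local Notation E := (repSpace F w).
Local Notation lev := (lev n Y).
Local Notation lab := (lab Y).
Local Notation level v := (fun i : 'I_(w v) => lev v i).

Definition base_rep : E :=
  fun a => \matrix_(r, c) (lab r == lab c)%:R.

(** Both [base_rep] and the direct sum of intervals have the basis labels
    [string_at n Y], hence are isomorphic. *)
Lemma orbit_of_arrayP (x : E) : orbit_of_array F w Y x <->
  exists2 g : forall v, 'M[F]_(w v),
    forall v, g v \in unitmx & forall a, x a = act g base_rep a.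
Proof.
have base_lab : labelled (QuiverRep base_rep) (@string_at n Y).
  exists (fun v i => lab i); split=> [v|v k|a r c].
  - exact: lab_inj.
  - exact: labP PY v k.
  - by rewrite mxE.
have base_iso : rep_iso (QuiverRep base_rep) (rep_of_array F n Y).
  by apply: labelled_iso base_lab (labelled_rep_of_array _ _); apply: Y_arrow PY.
rewrite -rep_iso_act /orbit_of_array /=; split=> iso.
  exact: rep_iso_trans base_iso (rep_iso_sym iso).
exact: rep_iso_trans (rep_iso_sym iso) base_iso.
Qed.

Lemma base_rep_strictly_up a : strictly_up (level (tgt a)) (level (src a)) (base_rep a).
Proof.
move=> r c le_cr; rewrite mxE; case: eqP => // /lab_arrow e.
by rewrite e ltnn in le_cr.
Qed.

Lemma base_rep_mulE a (r : 'I_(w (tgt a))) (i : 'I_(w (src a))) m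
    (M : 'M[F]_(w (src a), m)) j :
  lab r = lab i -> (base_rep a *m M) r j = M i j.
Proof.
move=> e; rewrite mxE; under eq_bigr => k _ do rewrite mxE e.
exact: (sum_label (b := fun i => lab i) (fun k => M k j) i (@lab_inj n w Y (src a))).
Qed.

(** * Moving a nearby strictly upper triangular point to the base point *)

(** The columns of [M] are put where [base_rep a] has its ones, so that
    [complete M *m base_rep a = M] when the columns of level [0] of [M] vanish;
    the other columns are those of the identity. *)
Definition complete a (M : 'M[F]_(w (tgt a), w (src a))) : 'M[F]_(w (tgt a)) :=
  \matrix_(r, s) if [pick c : 'I_(w (src a)) | lab c == lab s] is Some c
                 then M r c else (r == s)%:R.

Lemma complete_base_rep a : complete (base_rep a) = 1%:M.
Proof.
apply/matrixP => r s; rewrite !mxE; case: pickP => // c /eqP e.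
by rewrite mxE e (inj_eq (@lab_inj _ _ _ _)).
Qed.

Lemma complete_up_triangular a (M : 'M[F]_(w (tgt a), w (src a))) :
  strictly_up (level (tgt a)) (level (src a)) M ->
  up_triangular (level (tgt a)) (complete M).
Proof.
move=> Ms r s lt_sr; rewrite mxE; case: pickP => [c /eqP/esym/lab_arrow e|_].
  by apply: Ms; rewrite e.
by case: eqP lt_sr => // ->; rewrite ltnn.
Qed.

Lemma complete_mul_base_rep a (M : 'M[F]_(w (tgt a), w (src a))) :
  strictly_up (level (tgt a)) (level (src a)) M ->
  complete M *m base_rep a = M.
Proof.
move=> Ms; apply/matrixP => r c; rewrite mxE.
have [lc0|lc] := posnP (lev (src a) c).
  rewrite big1 ?Ms ?lc0 // => s _; rewrite [base_rep a s c]mxE.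
  by case: eqP => [/lab_arrow|]; rewrite ?lc0 ?mulr0.
have [s0 e0] := lab_next PY lc.
rewrite (bigD1 s0) //= [base_rep a s0 c]mxE e0 eqxx mulr1 big1 ?addr0; last first.
  move=> s ss0; rewrite [base_rep a s c]mxE -e0 (inj_eq (@lab_inj _ _ _ _)) (negbTE ss0).
  by rewrite mulr0.
rewrite mxE; case: pickP => [c' /eqP|/(_ c)]; last by rewrite e0 eqxx.
by rewrite e0 => /lab_inj ->.
Qed.

Lemma tgt_inj : injective (@tgt n).
Proof. by move=> a b /(congr1 val) [] e; apply: val_inj. Qed.

Definition tgt_inv (v : 'I_n) : {a | tgt a = v} + (forall a, tgt a <> v).
Proof.
case: (pickP (fun a => tgt a == v)) => [a /eqP e|none]; first by left; exists a.
by right=> a /eqP; rewrite none.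
Defined.

(** [straighten N] is the solution [q] of the equations
    [q (tgt a) = complete (N a *m q (src a))], with [q v = 1] at the first
    vertex; for a strictly upper triangular [N] they imply
    [q (tgt a) *m base_rep a = N a *m q (src a)]. As the
    type of [q v] depends on [v], it is obtained by iterating these equations on
    whole families, the value at [v] being final after [v] iterations. *)
Definition straighten_step (N : E) (q : forall v, 'M[F]_(w v)) :
    forall v, 'M[F]_(w v) :=
  fun v => match tgt_inv v with
  | inl (exist a e) =>
      eq_rect (tgt a) (fun u => 'M[F]_(w u)) (complete (N a *m q (src a))) v e
  | inr _ => 1%:M
  end.

Lemma straighten_step_tgt N q a :
  straighten_step N q (tgt a) = complete (N a *m q (src a)).
Proof.
rewrite /straighten_step; case: tgt_inv => [[a' e]|/(_ a)//].
have ea := tgt_inj e; subst a'; by rewrite (eq_irrelevance e erefl).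
Qed.

Lemma straighten_step_source N q v : (forall a, tgt a <> v) ->
  straighten_step N q v = 1%:M.
Proof.
by move=> nov; rewrite /straighten_step; case: tgt_inv => [[a e]|//]; case: (nov a e).
Qed.

Definition straighten (N : E) : forall v, 'M[F]_(w v) :=
  iter n (straighten_step N) (fun=> 1%:M).

(** Induction along the vertices, for properties of a single matrix. *)
Lemma straighten_ind (N : E) (P : forall v, 'M[F]_(w v) -> Prop) :
  (forall v, P v 1%:M) ->
  (forall a q, P (src a) q -> P (tgt a) (complete (N a *m q))) ->
  forall v, P v (straighten N v).
Proof.
move=> P1 PS; suff H k v : P v (iter k (straighten_step N) (fun=> 1%:M) v) by apply: H.
elim: k v => [|k IH] v /=; first exact: P1.
case: (tgt_inv v) => [[a <-]|nov]; last by rewrite straighten_step_source.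
by rewrite straighten_step_tgt; apply/PS/IH.
Qed.

Lemma straighten_tgt N a :
  straighten N (tgt a) = complete (N a *m straighten N (src a)).
Proof.
suff fix_ k (v : 'I_n) : (v <= k)%N ->
    iter k.+1 (straighten_step N) (fun=> 1%:M) v =
    iter k (straighten_step N) (fun=> 1%:M) v.
  rewrite /straighten -[LHS]fix_; last exact/ltnW/ltn_ord.
  exact: straighten_step_tgt.
elim: k v => [|k IH] v le_vk; case: (tgt_inv v) => [[a' e]|nov].
- by move: le_vk; rewrite -e.
- by rewrite /= straighten_step_source.
- have le_ak : (src a' <= k)%N by move: le_vk; rewrite -e.
  by rewrite -e iterS [in RHS]iterS !straighten_step_tgt IH.
- by rewrite iterS [in RHS]iterS !straighten_step_source.
Qed.

Lemma straighten_up_triangular (N : E) :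
  (forall a, strictly_up (level (tgt a)) (level (src a)) (N a)) ->
  forall v, up_triangular (level v) (straighten N v).
Proof.
move=> Ns; apply: (straighten_ind (P := fun v q => up_triangular (level v) q))
  => [v i j|a q qu].
  by rewrite mxE; case: eqP => // ->; rewrite ltnn.
by apply/complete_up_triangular/strictly_up_mulr.
Qed.

Lemma straighten_base_rep v : straighten base_rep v = 1%:M.
Proof.
apply: (straighten_ind (P := fun v q => q = 1%:M)) => // a _ ->.
by rewrite mulmx1 complete_base_rep.
Qed.

(** The recursive equations of [straighten N] say that it is a morphism from
    [base_rep] to [N]. *)
Lemma straighten_act (N : E) :
  (forall a, strictly_up (level (tgt a)) (level (src a)) (N a)) ->
  (forall v, straighten N v \in unitmx) ->
  forall a, N a = act (straighten N) base_rep a.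
Proof.
move=> Ns qU a; rewrite /act straighten_tgt complete_mul_base_rep.
  by rewrite -mulmxA mulmxV ?mulmx1.
exact/strictly_up_mulr/straighten_up_triangular.
Qed.

End Orbit.

Lemma polymx_straighten (F : fieldType) (T : finType) n (w : 'I_n -> nat) Y
    (N : (T -> F) -> repSpace F w) :
  (forall a, polymx (fun t => N t a)) ->
  forall v, polymx (fun t => straighten Y (N t) v).
Proof.
move=> Np v; rewrite /straighten; suff H k : polymx (fun t => iter k
    (straighten_step Y (N t)) (fun=> 1%:M) v) by apply: H.
elim: k v => [|k IH] v; first exact: polymxC.
case: (tgt_inv v) => [[a <-]|nov] i j /=.
  apply: (@eq_polyfun _ _ (fun t =>
    complete Y (N t a *m iter k (straighten_step Y (N t)) (fun=> 1%:M) (src a)) i j)).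
    by move=> t; rewrite straighten_step_tgt.
  case E : [pick c : 'I_(w (src a)) | lab Y c == lab Y j] => [c|].
    apply: (@eq_polyfun _ _ (fun t =>
      (N t a *m iter k (straighten_step Y (N t)) (fun=> 1%:M) (src a)) i c)).
      by move=> t; rewrite [RHS]mxE E.
    exact: polymxM.
  apply: (@eq_polyfun _ _ (fun=> (i == j)%:R)); last exact: polyfunC.
  by move=> t; rewrite [RHS]mxE E.
apply: (@eq_polyfun _ _ (fun=> (1%:M : 'M[F]_(w v)) i j)); last exact: polyfunC.
by move=> t; rewrite straighten_step_source.
Qed.

(** * Coordinates on a cell of the orbit *)

Section Cell.
Variables (F : fieldType) (n : nat) (w : 'I_n -> nat) (Y : nat -> nat -> nat).
Hypothesis PY : triangular_arrays w Y.
Local Notation E := (repSpace F w).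
Local Notation lev := (lev n Y).
Local Notation lab := (lab Y).
Local Notation level v := (fun i : 'I_(w v) => lev v i).
Local Notation base_rep := (@base_rep F n w Y).

Definition square : finType := {v : 'I_n & ('I_(w v) * 'I_(w v))%type}.

Definition free_entry (x : square + Defs.coord w) : bool :=
  match x with
  | inl s => (lev (tag s) (tagged s).2 < lev (tag s) (tagged s).1)%N
  | inr s => (lev (tgt (tag s)) (tagged s).1 < lev (src (tag s)) (tagged s).2)%N
  end.

Definition parameter : finType := {x : (square + Defs.coord w)%type | free_entry x}.

Definition base_entry (x : square + Defs.coord w) : F :=
  match x with
  | inl s => ((tagged s).1 == (tagged s).2)%:R
  | inr s => entry base_rep s
  end.

Definition base_point (y : parameter) : F := base_entry (val y).

Definition param_entry (t : parameter -> F) (x : square + Defs.coord w) : F :=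
  if insub x is Some y then t y else base_entry x.

Definition low_part (t : parameter -> F) v : 'M[F]_(w v) :=
  \matrix_(i, j) param_entry t
    (inl (Tagged (fun v => ('I_(w v) * 'I_(w v))%type) (i, j))).

Definition up_part (t : parameter -> F) : E := fun a =>
  \matrix_(r, c) param_entry t
    (inr (Tagged (fun a => ('I_(w (tgt a)) * 'I_(w (src a)))%type) (r, c))).

Definition cell (t : parameter -> F) : E := fun a =>
  invmx (low_part t (tgt a)) *m up_part t a *m low_part t (src a).

Lemma param_entry_base t x : (forall y, val y = x -> t y = base_point y) ->
  param_entry t x = base_entry x.
Proof.
move=> tb; rewrite /param_entry; case: insubP => // y _ e.
by rewrite tb // /base_point e.
Qed.

Lemma param_entry_fixed t x : ~~ free_entry x -> param_entry t x = base_entry x.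
Proof. by move=> nx; rewrite /param_entry insubN. Qed.

Lemma param_entry_val t y : param_entry t (val y) = t y.
Proof. by rewrite /param_entry valK. Qed.

Lemma low_part_low_unipotent t v : low_unipotent (level v) (low_part t v).
Proof. by move=> i j lij; rewrite mxE param_entry_fixed //= -leqNgt. Qed.

Lemma up_part_strictly_up t a :
  strictly_up (level (tgt a)) (level (src a)) (up_part t a).
Proof.
move=> r c lcr; rewrite mxE param_entry_fixed /= -?leqNgt // /entry /=.
exact: base_rep_strictly_up.
Qed.

Lemma low_part_det t v : \det (low_part t v) = 1.
Proof.
apply: (@low_unipotent_det _ _ (level v)); last exact: low_part_low_unipotent.
exact: (@lev_homo n w Y v).
Qed.

Lemma low_part_unit t v : low_part t v \in unitmx.
Proof. by rewrite unitmxE low_part_det unitr1. Qed.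

Lemma parts_surjective (V : forall v, 'M[F]_(w v)) (N : E) :
  (forall v, low_unipotent (level v) (V v)) ->
  (forall a, strictly_up (level (tgt a)) (level (src a)) (N a)) ->
  exists t, (forall v, low_part t v = V v) /\ (forall a, up_part t a = N a).
Proof.
move=> Vl Ns.
exists (fun y => match val y with
  | inl s => V (tag s) (tagged s).1 (tagged s).2
  | inr s => entry N s end).
split=> u; apply/matrixP => i j; rewrite mxE /param_entry.
  case: insubP => [y _ -> //|]; rewrite /= -leqNgt => /Vl ->.
  by [].
case: insubP => [y _ -> //|]; rewrite /= -leqNgt => lji.
by rewrite (Ns u) // /entry /= base_rep_strictly_up.
Qed.

(** * The cell is parametrized by polynomials *)

Lemma polyfun_param_entry x : polyfun (fun t => param_entry t x).
Proof.
rewrite /param_entry; case: insubP => [y _ _|_]; first exact: polyfun_var.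
exact: polyfunC.
Qed.

Lemma polymx_low_part v : polymx (fun t => low_part t v).
Proof.
move=> i j; apply: eq_polyfun (polyfun_param_entry _) => t.
by rewrite [RHS]mxE.
Qed.

Lemma polymx_up_part a : polymx (fun t => up_part t a).
Proof.
move=> i j; apply: eq_polyfun (polyfun_param_entry _) => t.
by rewrite [RHS]mxE.
Qed.

Lemma polymx_cell a : polymx (fun t => cell t a).
Proof.
rewrite /cell; apply: polymxM; last exact: polymx_low_part.
apply: polymxM; last exact: polymx_up_part.
have inv_adj t : invmx (low_part t (tgt a)) = \adj (low_part t (tgt a)).
  by rewrite /invmx low_part_unit low_part_det invr1 scale1r.
move=> i j; apply: (@eq_polyfun _ _ (fun t => (\adj (low_part t (tgt a))) i j)).
  by move=> t; rewrite inv_adj.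
exact: (polymx_adj (@polymx_low_part (tgt a))).
Qed.

(** * The translates of the cell by permutations cover the orbit *)

Definition translated_cell (s : {dffun forall v, 'S_(w v)}) (t : parameter -> F) : E :=
  fun a => perm_mx (s (tgt a)) *m cell t a *m invmx (perm_mx (s (src a))).

Lemma polyfun_translated_cell s c : polyfun (fun t => entry (translated_cell s t) c).
Proof.
case: c => a [r c]; rewrite /entry /translated_cell /=.
apply: (polymxM (N := fun=> _)); last exact: polymxC.
by apply: (polymxM (M := fun=> _)); [exact: polymxC|exact: polymx_cell].
Qed.

(** If [g = s v p] is the big cell decomposition of the element that takes
    [base_rep] to [x], then [p] keeps [base_rep] strictly upper triangular and
    [v], [s] are accounted for by the cell and by its translation. *)
Lemma translated_cells_cover x : orbit_of_array F w Y x ->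
  exists s t, x = translated_cell s t.
Proof.
case/(orbit_of_arrayP PY) => g gU xE.
have /fin_all_exists[d dP] : forall v, exists d : 'S_(w v) * 'M[F]_(w v) * 'M[F]_(w v),
    [/\ low_unipotent (level v) d.1.2, up_triangular (level v) d.2
      & g v = perm_mx d.1.1 *m d.1.2 *m d.2].
  move=> v; have [s [u [p ?]]] := big_cell_decomposition (@lev_homo n w Y v) (gU v).
  by exists (s, u, p).
pose u v := (d v).1.2; pose p v := (d v).2.
have gE v : g v = perm_mx (d v).1.1 *m u v *m p v by have [] := dP v.
have [uU pU] : (forall v, u v \in unitmx) /\ (forall v, p v \in unitmx).
  by split=> v; have := gU v; rewrite gE !unitmx_mul => /andP[/andP[]].
have [] := @parts_surjective (fun v => invmx (u v))
    (fun a => p (tgt a) *m base_rep a *m invmx (p (src a))).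
- by move=> v; apply: low_unipotent_invmx => //; have [] := dP v.
- move=> a; apply: strictly_up_mulr; last first.
    by apply: up_triangular_invmx => //; have [] := dP (src a).
  by apply: strictly_up_mull; [apply: base_rep_strictly_up|have [] := dP (tgt a)].
move=> t [lowE upE]; exists [ffun v => (d v).1.1], t.
apply: functional_extensionality_dep => a.
rewrite xE /act /translated_cell /cell lowE lowE upE invmxK !ffunE !gE.
have pmU v : (perm_mx (d v).1.1 : 'M[F]_(w v)) \in unitmx by apply: unitmx_perm.
by rewrite !invmx_mulmx ?unitmx_mul ?pmU ?uU ?pU // !mulmxA.
Qed.

(** * Near the base point the cell lies in the orbit *)

Definition cell_det (t : parameter -> F) : F :=
  \prod_v \det (straighten Y (up_part t) v).

Lemma polyfun_cell_det : polyfun cell_det.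
Proof.
apply: polyfun_prod => v; apply: polyfun_det; apply: polymx_straighten => a.
exact: polymx_up_part.
Qed.

Lemma up_part_base t :
  (forall y s, val y = inr s -> t y = base_point y) -> up_part t = base_rep.
Proof.
move=> tb; apply: functional_extensionality_dep => a; apply/matrixP => r c.
by rewrite mxE param_entry_base // => y; apply: tb.
Qed.

Lemma cell_det_base_point : cell_det base_point != 0.
Proof.
rewrite /cell_det big1 ?oner_eq0 // => v _.
by rewrite up_part_base // straighten_base_rep det1.
Qed.

(** The lower unipotent matrices act within the orbit, so only the strictly upper
    triangular part matters. *)
Lemma cell_in_orbit t : cell_det t != 0 -> orbit_of_array F w Y (cell t).
Proof.
move/prodf_neq0 => dN0.
pose q := straighten Y (up_part t).
have qU v : q v \in unitmx by rewrite unitmxE unitfE; apply: dN0.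
apply/(orbit_of_arrayP PY); exists (fun v => invmx (low_part t v) *m q v).
  by move=> v; rewrite unitmx_mul unitmx_inv low_part_unit qU.
move=> a; rewrite /cell (straighten_act PY (up_part_strictly_up t) qU) /act.
by rewrite invmx_mulmx ?unitmx_inv ?low_part_unit // invmxK !mulmxA.
Qed.

(** * Each parameter is a coordinate once the later ones are at the base point *)

(** The order in which parameters are freed: the lower unipotent matrices, from
    the first vertex to the last one, and after them the entries of the strictly
    upper triangular matrices, by increasing distance from the diagonal
    blocks. *)
Definition entry_stage (x : square + Defs.coord w) : nat :=
  match x with
  | inl s => tag s
  | inr s => n + (lev (src (tag s)) (tagged s).2 - lev (tgt (tag s)) (tagged s).1)
  end.

Definition stage_of (y : parameter) : nat := entry_stage (val y).

Lemma stage_of_val y x : val y = x -> stage_of y = entry_stage x.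
Proof. by move=> <-. Qed.

(** While the later matrices are trivial, the arrow [a] that leaves [v] carries
    [base_rep a *m low_part t v], which copies the rows of positive level of
    [low_part t v]. *)
Lemma low_entry_detected (v : 'I_n) (i j : 'I_(w v)) :
  (lev v j < lev v i)%N ->
  exists c : Defs.coord w, forall t,
    (forall y, (v < stage_of y)%N -> t y = base_point y) ->
    entry (cell t) c = low_part t v i j.
Proof.
move=> lji.
have [a ev] : exists a, v = src a.
  have lt_v : (v < n.-1)%N by have := lev_lt PY i; lia.
  by exists (Ordinal lt_v); apply: val_inj.
subst v; have [r er] := lab_next PY (leq_ltn_trans (leq0n _) lji).
exists (Tagged (fun a => ('I_(w (tgt a)) * 'I_(w (src a)))%type) (r, j)) => t tb.
rewrite /entry /cell /=.
have -> : up_part t = base_rep.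
  apply: up_part_base => y s ys; apply: tb; rewrite (stage_of_val ys) /=.
  by have := ltn_ord (src a) => /=; lia.
have -> : low_part t (tgt a) = 1%:M.
  apply/matrixP => i' j'; rewrite !mxE param_entry_base //= => y ys; apply: tb.
  by rewrite (stage_of_val ys).
by rewrite invmx1 mul1mx (base_rep_mulE _ _ er).
Qed.

(** Multiplying by lower unipotent matrices adds to the entry [(r, c)] only
    multiples of entries farther from the diagonal blocks. *)
Lemma up_entry_detected a (r : 'I_(w (tgt a))) (c : 'I_(w (src a))) t :
  (lev (tgt a) r < lev (src a) c)%N ->
  (forall y, (n + (lev (src a) c - lev (tgt a) r) < stage_of y)%N ->
     t y = base_point y) ->
  cell t a r c = up_part t a r c.
Proof.
move=> lrc tb.
(* An entry farther from the diagonal blocks than [(r, c)] still vanishes. *)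
have far (r' : 'I_(w (tgt a))) (c' : 'I_(w (src a))) :
    (lev (src a) c - lev (tgt a) r < lev (src a) c' - lev (tgt a) r')%N ->
    up_part t a r' c' = 0.
  move=> lt_d; rewrite mxE param_entry_base /=; last first.
    by move=> y ys; apply: tb; rewrite (stage_of_val ys) /= ltn_add2l.
  by rewrite /entry mxE /=; case: eqP => // /lab_arrow /=; move: lrc lt_d => /=; lia.
have lu := low_unipotent_invmx (low_part_unit t (tgt a))
  (@low_part_low_unipotent t (tgt a)).
have ll := @low_part_low_unipotent t (src a).
rewrite /cell mxE (bigD1 c) //= ll // eqxx mulr1 [X in _ + X]big1 ?addr0; last first.
  move=> c' nc; have [lc'|lc] := leqP (lev (src a) c') (lev (src a) c).
    by rewrite ll // (negbTE nc) mulr0.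
  rewrite mxE big1 ?mul0r // => r' _.
  have [lr|lr'] := leqP (lev (tgt a) r) (lev (tgt a) r'); last first.
    by rewrite far ?mulr0 //; move: lrc lc lr' => /=; lia.
  rewrite lu //; case: eqP => [<-|_]; last by rewrite mul0r.
  by rewrite far ?mulr0 //; move: lrc lc => /=; lia.
rewrite mxE (bigD1 r) //= lu // eqxx mul1r big1 ?addr0 // => r' nr.
have [lr|lr'] := leqP (lev (tgt a) r) (lev (tgt a) r').
  by rewrite lu // eq_sym (negbTE nr) mul0r.
by rewrite far ?mulr0 //; move: lrc lr' => /=; lia.
Qed.

Lemma parameter_detected y : exists c : Defs.coord w, forall t,
  (forall y', (stage_of y < stage_of y')%N -> t y' = base_point y') ->
  entry (cell t) c = t y.
Proof.
have := valP y; case E : (val y) => [[v [i j]]|[a [r c]]] /= free.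
  have [c cP] := low_entry_detected free; exists c => t tb.
  rewrite cP ?mxE -?E ?param_entry_val // => y' vy'.
  by apply: tb; rewrite (stage_of_val E).
exists (Tagged (fun a => ('I_(w (tgt a)) * 'I_(w (src a)))%type) (r, c)) => t tb.
rewrite /entry /= up_entry_detected ?mxE -?E ?param_entry_val // => y' vy'.
by apply: tb; rewrite (stage_of_val E).
Qed.

(** * Number of parameters *)

(** The bound on the vertices ensures that no block of [u] below a level of [v] is
    missing; it holds for equal and for consecutive vertices. *)
Lemma card_level_pairs (u v : 'I_n) : (n - v <= (n - u).+1)%N ->
  (\sum_(c < w v) \sum_(r < w u) (lev u r < lev v c) =
   \sum_(k < n - v) \sum_(j < k) Y u j * Y v k)%N.
Proof.
move=> le_vu.
rewrite (sum_lev PY v (fun k => \sum_(r < w u) (lev u r < k))%N).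
apply: eq_bigr => k _; rewrite (sum_lev PY u (fun l => (l < k)%N : nat)).
rewrite (big_ord_widen (n - u) (fun j => Y u j * Y v k)%N); last first.
  by have := ltn_ord k; lia.
rewrite [RHS]big_mkcond big_distrr /=; apply: eq_bigr => l _.
by case: ifP; rewrite ?muln0 // muln1 mulnC.
Qed.

Lemma card_parameter : #|parameter| =
  (\sum_(i < n.-1) \sum_(k < n - i) \sum_(j < k) Y i j * Y i k +
   \sum_(i < n.-1) \sum_(k < n - i) \sum_(j < k) Y i.+1 j * Y i k)%N.
Proof.
rewrite card_sig -sum1_card big_mkcond big_sumType /=; congr addn.
  transitivity (\sum_(v < n) \sum_(k < n - v) \sum_(j < k) Y v j * Y v k)%N.
    transitivity (\sum_(v < n) \sum_(ij : 'I_(w v) * 'I_(w v))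
        (lev v ij.2 < lev v ij.1))%N.
      rewrite sig_big_dep /=; apply: eq_bigr => s _.
      by rewrite inE /=; case: ifP.
    apply: eq_bigr => v _; rewrite -card_level_pairs //.
    by rewrite pair_bigA.
  (* The last vertex has a single block, hence no pair of distinct levels. *)
  case: (n) => [|m]; first by rewrite !big_ord0.
  by rewrite big_ord_recr /= subSnn big_ord1 big_ord0 addn0.
transitivity (\sum_(a < n.-1) \sum_(rc : 'I_(w (tgt a)) * 'I_(w (src a)))
    (lev (tgt a) rc.1 < lev (src a) rc.2))%N.
  rewrite sig_big_dep /=; apply: eq_bigr => s _.
  by rewrite inE /=; case: ifP.
apply: eq_bigr => a _; rewrite -(card_level_pairs (u := tgt a) (v := src a)) /=.
  by rewrite exchange_big pair_bigA.
by have := ltn_ord a; lia.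
Qed.

End Cell.

Theorem theorem4p6 (R : realType) (n : nat) (n_gt0 : (0 < n)%N)
    (w : 'I_n -> nat) (Y : nat -> nat -> nat)
    (PY : triangular_arrays w Y) :
  has_dim (orbit_of_array R[i] w Y)
    (\sum_(i < n.-1) \sum_(k < n - i) \sum_(j < k) Y i j * Y i k +
     \sum_(i < n.-1) \sum_(k < n - i) \sum_(j < k) Y i.+1 j * Y i k)%N.
Proof.
rewrite -(card_parameter PY); split; last first.
  move=> e Z; apply: (chain_length_le (Psi := @translated_cell R[i] n w Y)).
    exact: polyfun_translated_cell.
  by move=> x /(translated_cells_cover PY).
apply: (chain_of_images (Phi := @cell R[i] n w Y) (g := @cell_det R[i] n w Y)
  (b := @base_point R[i] n w Y) (key := @stage_of n w Y)).
- by case=> a [r c]; apply: polymx_cell.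
- exact: polyfun_cell_det.
- exact: cell_det_base_point.
- by move=> t; apply: cell_in_orbit.
- exact: parameter_detected.
Qed.
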